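(* For $r \ge 1$ let $M_{4,r}$ be the set of equilateral spatial quadrilaterals (with unit edges, modulo $SO(3)$) of diameter at most $r$, let $\mu$ be the symplectic volume measure, and let $$\bar\kappa_{4,r} = \frac{1}{\mu(M_{4,r})}\int_{M_{4,r}} \sum_{i=1}^{4} \angle(e_i,e_{i+1})\, d\mu$$ be the expected total curvature. Then $\bar\kappa_{4,r}$ is non-increasing as a function of $r$; that is, $\bar\kappa_{4,r'} \le \bar\kappa_{4,r}$ whenever $1 \le r \le r'$.
   Context: Let $\mathbb{S}^2_1\subset\mathbb{R}^3$ be the unit sphere. The moduli space of equilateral spatial quadrilaterals is $M_4 = \{(e_1,e_2,e_3,e_4)\in(\mathbb{S}^2_1)^4 : e_1+e_2+e_3+e_4=0\}/SO(3)$. The vertices are $v_1,\dots,v_4$, where $e_i = v_{i+1}-v_i$ (indices modulo $4$). $\angle(e_i,e_{i+1})\in[0,\pi]$ is the angle between the vectors $e_i$ and $e_{i+1}$ (indices modulo $4$), and $\sum_{i=1}^4\angle(e_i,e_{i+1})$ is the total curvature. Action-angle coordinates on $M_4$ (defined off a set of positive codimension, which has measure zero) are $(\ell,\theta)\in(0,2)\times[0,2\pi)$: with $\ell = 2\cos\phi$, $\phi \in (0,\pi/2)$, the point with coordinates $(\ell,\theta)$ is the class of the quadrilateral with vertices $v_1=(0,0,0)$, $v_2=(\cos\phi,\sin\phi,0)$, $v_3=(2\cos\phi,0,0)$, $v_4=(\cos\phi,\sin\phi\cos\theta,\sin\phi\sin\theta)$. Thus $\ell=d(v_1,v_3)$,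 and $\theta$ is the angle of rotation about the line $\overline{v_1v_3}$ between the triangles $v_1v_2v_3$ and $v_1v_4v_3$. The symplectic volume measure is $d\mu = d\ell\, d\theta$. The diameter of a quadrilateral is the maximum distance between two of its vertices, and $M_{4,r}$ is the set of elements of $M_4$ with diameter at most $r$, i.e. $\|\sum_{i=j}^k e_i\|\le r$ for all $1\le j\le k\le 4$. *)

(* Defs.v *)
From HB Require Import structures.
From mathcomp Require Import all_boot all_order all_algebra.
From mathcomp Require Import all_classical all_reals all_analysis.
From mathcomp Require Import ring.
Import Order.TTheory GRing.Theory Num.Theory.
Import numFieldNormedType.Exports.
Set Implicit Arguments.
Unset Strict Implicit.
Unset Printing Implicit Defensive.
Local Open Scope classical_set_scope.
Local Open Scope ring_scope.
Local Open Scope quotient_scope.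

Section Euclidean.
Variable R : realType.

(* The library norm on row vectors is the sup norm, hence a separate
   Euclidean norm. *)
Definition dot (u v : 'rV[R]_3) : R := \sum_(j < 3) u 0 j * v 0 j.
Definition enorm (u : 'rV[R]_3) : R := Num.sqrt (dot u u).

Definition angle (u v : 'rV[R]_3) : R := acos (dot u v / (enorm u * enorm v)).

Definition SO3 : set 'M[R]_3 := [set g | g *m g^T = 1%:M /\ \det g = 1].

Lemma dotE u v : dot u v = (u *m v^T) 0 0.
Proof. by rewrite mxE; apply: eq_bigr => j _; rewrite mxE. Qed.

Lemma dot_SO3 g u v : SO3 g -> dot (u *m g) (v *m g) = dot u v.
Proof.
by move=> [gg _]; rewrite !dotE trmx_mul -mulmxA (mulmxA g) gg mul1mx.
Qed.

Lemma enorm_SO3 g u : SO3 g -> enorm (u *m g) = enorm u.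
Proof. by move=> hg; rewrite /enorm dot_SO3. Qed.

Lemma angle_SO3 g u v : SO3 g -> angle (u *m g) (v *m g) = angle u v.
Proof. by move=> hg; rewrite /angle dot_SO3 // !enorm_SO3. Qed.

Lemma SO3_1 : SO3 1%:M.
Proof. by split; rewrite ?det1 // trmx1 mulmx1. Qed.

Lemma SO3_mul g h : SO3 g -> SO3 h -> SO3 (g *m h).
Proof.
move=> [gg dg] [hh dh]; split; last by rewrite det_mulmx dg dh mulr1.
by rewrite trmx_mul -mulmxA (mulmxA h) hh mul1mx.
Qed.

Lemma SO3_tr g : SO3 g -> SO3 g^T.
Proof. by move=> [gg dg]; split; rewrite ?det_tr // trmxK (mulmx1C gg). Qed.

End Euclidean.

Section Polygons.
Variable R : realType.

(* Row [i] of the matrix is the edge e_(i+1), for i = 0, ..., 3. *)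
Definition closed_polygon (E : 'M[R]_(4, 3)) : bool :=
  [forall i, enorm (row i E) == 1] && (\sum_(i < 4) row i E == 0).

Definition polygon := {E : 'M[R]_(4, 3) | closed_polygon E}.

(* Rotations act on row vectors by right multiplication; [ordS] is the
   successor modulo 4. *)
Definition rotation_eq (E F : polygon) : bool :=
  `[< exists2 g, SO3 g & val F = val E *m g >].

Lemma rotation_eq_refl : reflexive rotation_eq.
Proof.
by move=> E; apply/asboolP; exists 1%:M; [exact: SO3_1 | rewrite mulmx1].
Qed.

Lemma rotation_eq_sym : symmetric rotation_eq.
Proof.
suff H E F : rotation_eq E F -> rotation_eq F E.
  by move=> E F; apply/idP/idP; exact: H.
move=> /asboolP[g hg EF]; apply/asboolP; exists g^T; first exact: SO3_tr.
by rewrite EF -mulmxA; case: hg => -> _; rewrite mulmx1.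
Qed.

Lemma rotation_eq_trans : transitive rotation_eq.
Proof.
move=> F E G /asboolP[g hg EF] /asboolP[h hh FG]; apply/asboolP.
by exists (g *m h); [exact: SO3_mul | rewrite FG EF mulmxA].
Qed.

Canonical rotation_equiv :=
  EquivRel rotation_eq rotation_eq_refl rotation_eq_sym rotation_eq_trans.

Definition M4 := {eq_quot rotation_equiv}.
HB.instance Definition _ := Choice.on M4.
HB.instance Definition _ := EqQuotient.on M4.

(* The translation is fixed by placing vertex 0 (v_1 in one-based numbering) at the
   origin. *)
Definition vertex (E : 'M[R]_(4, 3)) (k : 'I_4) : 'rV[R]_3 :=
  \sum_(i < 4 | (i < k)%N) row i E.

Definition polygon_diameter (E : 'M[R]_(4, 3)) : R :=
  \big[Num.max/0]_(j < 4) \big[Num.max/0]_(k < 4)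
    enorm (vertex E k - vertex E j).

Definition polygon_curvature (E : 'M[R]_(4, 3)) : R :=
  \sum_(i < 4) angle (row i E) (row (ordS i) E).

Definition diameter (x : M4) : R := polygon_diameter (val (repr x)).
Definition total_curvature (x : M4) : R := polygon_curvature (val (repr x)).

Lemma pi_rotation (E : polygon) :
  exists2 g, SO3 g & val (repr (\pi_M4 E)) = val E *m g.
Proof.
by apply/asboolP; rewrite -/(rotation_eq _ _); apply/eqmodP; rewrite reprK.
Qed.

Lemma diameter_pi (E : polygon) :
  diameter (\pi_M4 E) = polygon_diameter (val E).
Proof.
rewrite /diameter; have [g hg ->] := pi_rotation E.
have vg k : vertex (val E *m g) k = vertex (val E) k *m g.
  by rewrite /vertex mulmx_suml; apply: eq_bigr => i _; rewrite row_mul.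
apply: eq_bigr => j _; apply: eq_bigr => k _.
by rewrite !vg -mulmxBl enorm_SO3.
Qed.

Lemma total_curvature_pi (E : polygon) :
  total_curvature (\pi_M4 E) = polygon_curvature (val E).
Proof.
rewrite /total_curvature; have [g hg ->] := pi_rotation E.
by apply: eq_bigr => i _; rewrite !row_mul angle_SO3.
Qed.

Definition M4r (r : R) : set M4 := [set x | diameter x <= r].

End Polygons.

Section ActionAngle.
Variable R : realType.

Definition vec3 (x y z : R) : 'rV[R]_3 := \row_(j < 3) [:: x; y; z]`_j.

Definition aa_vertex (phi theta : R) (k : 'I_4) : 'rV[R]_3 :=
  nth 0 [:: vec3 0 0 0;
            vec3 (cos phi) (sin phi) 0;
            vec3 (2 * cos phi) 0 0;
            vec3 (cos phi) (sin phi * cos theta) (sin phi * sin theta)] k.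

Definition aa_edges (phi theta : R) : 'M[R]_(4, 3) :=
  \matrix_(i < 4) (aa_vertex phi theta (ordS i) - aa_vertex phi theta i).

Lemma aa_closed phi theta : closed_polygon (aa_edges phi theta).
Proof.
apply/andP; split.
  apply/forallP => i; rewrite /enorm rowK /dot.
  suff -> : \sum_(j < 3)
      (aa_vertex phi theta (ordS i) - aa_vertex phi theta i) 0 j *
      (aa_vertex phi theta (ordS i) - aa_vertex phi theta i) 0 j = 1.
    by rewrite sqrtr1.
  have cs : cos phi ^+ 2 = 1 - sin phi ^+ 2 by rewrite -(cos2Dsin2 phi) addrK.
  have ct : cos theta ^+ 2 = 1 - sin theta ^+ 2.
    by rewrite -(cos2Dsin2 theta) addrK.
  case: i => [[|[|[|[|//]]]]] hi;
    rewrite /aa_vertex /= !big_ord_recr big_ord0 /= !mxE /=.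
  - ring: cs.
  - ring: cs.
  - ring: cs ct.
  - ring: cs ct.
under eq_bigr do rewrite rowK.
by rewrite sumrB [X in _ - X](reindex_inj (@ordS_inj 4)) subrr.
Qed.

(* [measurableTypeR R] is [R] with its Borel sigma-algebra, as used by
   [lebesgue_measure]. *)
Definition aa_coord := (measurableTypeR R * measurableTypeR R)%type.

(* The polygon is defined for every real [p.1], but represents the point with
   action-angle coordinates [p] only on [aa_domain]. *)
Definition aa_polygon (p : aa_coord) : polygon R :=
  exist _ (aa_edges (acos (p.1 / 2)) p.2) (aa_closed (acos (p.1 / 2)) p.2).

Definition aa_chart (p : aa_coord) : M4 R := \pi_(M4 R) (aa_polygon p).

Definition aa_domain : set aa_coord := `]0, 2[ `*` `[0, 2 * pi[.

Lemma measurable_aa_domain : measurable aa_domain.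
Proof. by apply: measurableX; exact: measurable_itv. Qed.

(* The largest sigma-algebra on M4 making the action-angle chart measurable. *)
Definition M4_measurable : set (set (M4 R)) :=
  image_set_system setT aa_chart measurable.

Lemma M4_measurableE A : M4_measurable A = measurable (aa_chart @^-1` A).
Proof. by rewrite /M4_measurable /image_set_system /= setTI. Qed.

Lemma M4_measurable0 : M4_measurable set0.
Proof. by rewrite M4_measurableE preimage_set0. Qed.

Lemma M4_measurableC A : M4_measurable A -> M4_measurable (~` A).
Proof. by rewrite !M4_measurableE preimage_setC; exact: measurableC. Qed.

Lemma M4_measurable_bigcup (F : (set (M4 R))^nat) :
  (forall i, M4_measurable (F i)) -> M4_measurable (\bigcup_i F i).
Proof.
move=> mF; rewrite M4_measurableE preimage_bigcup.
by apply: bigcup_measurable => i _; rewrite -M4_measurableE.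
Qed.

HB.instance Definition _ := isPointed.Build (M4 R) (aa_chart (1, 0)).
HB.instance Definition _ := @isMeasurable.Build default_measure_display (M4 R)
  M4_measurable M4_measurable0 M4_measurableC M4_measurable_bigcup.

Lemma measurable_aa_chart : measurable_fun setT aa_chart.
Proof. by move=> _ A mA; rewrite setTI -M4_measurableE. Qed.

(* The image under the chart of the measure dl dtheta on [aa_domain]. *)
Definition symplectic_volume : set (M4 R) -> \bar R :=
  pushforward
    (mrestr (@lebesgue_measure R \x @lebesgue_measure R)%E
      measurable_aa_domain)
    aa_chart.

Let symplectic_volume0 : symplectic_volume set0 = 0%E.
Proof. by rewrite /symplectic_volume /pushforward preimage_set0 measure0. Qed.

Let symplectic_volume_ge0 A : (0 <= symplectic_volume A)%E.
Proof. exact: measure_ge0. Qed.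

Let symplectic_volume_sigma_additive : semi_sigma_additive symplectic_volume.
Proof.
move=> F mF tF mUF; rewrite /symplectic_volume /pushforward preimage_bigcup.
apply: measure_semi_sigma_additive.
- by move=> n; rewrite -M4_measurableE; exact: mF.
- apply/trivIsetP => /= i j _ _ ij; rewrite -preimage_setI.
  by move/trivIsetP : tF => /(_ _ _ _ _ ij) ->//; rewrite preimage_set0.
- by rewrite -preimage_bigcup -M4_measurableE.
Qed.

HB.instance Definition _ := isMeasure.Build _ _ _ symplectic_volume
  symplectic_volume0 symplectic_volume_ge0 symplectic_volume_sigma_additive.

Definition expected_total_curvature (r : R) : R :=
  (fine (symplectic_volume (M4r r)))^-1 *
  \int[symplectic_volume]_(x in M4r r) total_curvature x.

End ActionAngle.

(* Main.v *)
Require Import Defs.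
From mathcomp Require Import all_boot all_order all_algebra.
From mathcomp Require Import all_classical all_reals all_analysis.
From mathcomp Require Import measurable_realfun ring lra.
Import Order.TTheory GRing.Theory Num.Theory.
Import numFieldNormedType.Exports.
Set Implicit Arguments.
Unset Strict Implicit.
Unset Printing Implicit Defensive.
Local Open Scope classical_set_scope.
Local Open Scope ring_scope.

(* Let l and d be the lengths of the two diagonals.  The total curvature is
   4 acos(l/2) + 4 acos(d/2), and for r >= 1 the diameter is at most r iff
   l <= r and d <= r.  By Archimedes' theorem the measure dl dtheta becomes
   4 dl dd / sqrt(4 - l^2 - d^2), which is symmetric in (l, d).
   - For r <= sqrt 2 the mean curvature is twice the mean of the decreasing
     function 4 acos(l/2) for the weight w_r(l) = 4 asin(r / sqrt(4 - l^2)) on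
     ]0, r].  Concavity of a |-> asin(k sin a) gives
     w_r(l) w_s(m) >= w_r(m) w_s(l) for l <= m and r <= s, and Chebyshev's
     inequality applies.
   - For r >= sqrt 2, passing from r to s adds the two disjoint strips
     r < l <= s and r < d <= s, of equal measure and equal curvature.  The mean
     curvature of the polygons with l = x is nonincreasing in x, so it suffices
     that at r = sqrt 2 it is at most the mean over the region, which holds with
     room to spare. *)

(** * Trigonometric inequalities *)

Section Trigonometry.
Variable R : realType.
Implicit Types (x y k a b : R).

(** The threshold sqrt 2 comes from l^2 + d^2 <= 4 on the coordinate domain. If r >= sqrt 2, the two
    diagonals cannot both exceed r, which makes the strips disjoint. If r <= sqrt 2, then r / sqrt(4
    - l^2) <= 1 for every l <= r, so the arcsine formula for w_r is valid on all of ]0, r].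
    Chebyshev's inequality does not extend further: for sqrt 2 < r < 2 the weight saturates at 2 pi
    for l near r while it still grows with r at small l, and the inequality between the weights
    fails. The symmetry in (l, d) is proved for image measures, not by a change of variables: theta
    and 2 pi - theta give the same d, and the density blows up along l^2 + d^2 = 4. Comparing the
    measures of quadrants needs only a one-variable arcsine integral and Tonelli. Means are compared
    in the cross-multiplied form C(s) V(r) <= C(r) V(s), with V the volume and C the total curvature
    integral; positivity of V enters only at the end. *)

Lemma MVT_deriv (f df : R -> R) a b : a <= b ->
  (forall x, is_derive x 1 f (df x)) ->
  exists2 c, a <= c <= b & f b - f a = df c * (b - a).
Proof.
move=> ab fdf.
have fc : {within `[a, b], continuous f}.
  apply: continuous_subspaceT => x.
  by apply/differentiable_continuous/derivable1_diffP; case: (fdf x).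
have [c cab ->] := MVT_segment ab (fun x _ => fdf x) fc.
by exists c => //; move: cab; rewrite in_itv.
Qed.

Lemma sin_le x : 0 <= x -> sin x <= x.
Proof.
move=> x0; have [y c] := MVT_deriv x0 (@is_derive_sin R).
rewrite sin0 !subr0 => ->; apply: ler_piMl => //; exact: cos_le1.
Qed.

Lemma sin_ge0_pihalf x : 0 <= x <= pi / 2 -> 0 <= sin x.
Proof.
by move=> /andP[x0 xp]; apply: sin_ge0_pi; have := @pi_gt0 R; lra.
Qed.

Lemma asin_acos x : -1 <= x <= 1 -> asin x = pi / 2 - acos x.
Proof.
move=> x11; have a0 := acos_ge0 x11; have ap := acos_lepi x11.
have xE : x = sin (pi / 2 - acos x).
  by rewrite -opprB sinN sinBpihalf opprK acosK// in_itv.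
rewrite [in LHS]xE sinK// in_itv /=; apply/andP; split; lra.
Qed.

Lemma asin0 : asin 0 = 0 :> R.
Proof. by rewrite asin_acos ?acos0 ?subrr//; apply/andP; split; lra. Qed.

Lemma ler_asin x y : -1 <= x -> x <= y -> y <= 1 -> asin x <= asin y.
Proof.
move=> x1 xy y1.
have x11 : -1 <= x <= 1 by rewrite x1 (le_trans xy).
have y11 : -1 <= y <= 1 by rewrite y1 (le_trans x1).
have h (z : R) : -1 <= z <= 1 -> asin z \in `[(- (pi / 2)), pi / 2].
  by move=> z11; rewrite in_itv /= asin_geNpi2// asin_lepi2.
by rewrite leNgt -ltr_sin ?h// !asinK ?in_itv// -leNgt.
Qed.

Lemma asin_ge0 x : 0 <= x <= 1 -> 0 <= asin x.
Proof. by move=> /andP[x0 x1]; rewrite -asin0 ler_asin//; lra. Qed.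

Lemma asin_ge x : 0 <= x <= 1 -> x <= asin x.
Proof.
move=> /andP[x0 x1]; rewrite -[leLHS]asinK; last by rewrite in_itv /=; lra.
by apply: sin_le; apply: asin_ge0; rewrite x0.
Qed.

Lemma is_derive_asin_sin k x : 0 <= k < 1 ->
  is_derive x 1 (fun a => asin (k * sin a))
    (k * cos x / Num.sqrt (1 - (k * sin x) ^+ 2)).
Proof.
move=> /andP[k0 k1].
have ks : -1 < k * sin x < 1.
  have := sin_max x; rewrite -ltr_norml normrM (ger0_norm k0) => sx.
  by apply: le_lt_trans k1; apply: ler_piMr.
have ds : is_derive x 1 (fun a => k * sin a) (k * cos x).
  by apply: is_derive_eq; rewrite ?scaler0 ?addr0 ?mulr1.
rewrite [X in is_derive _ _ _ X]mulrC.
exact: (@is_derive1_comp R (@asin R) (fun a => k * sin a) x).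
Qed.

Lemma deriv_asin_sin_le1 k x : 0 <= k < 1 ->
  k * cos x / Num.sqrt (1 - (k * sin x) ^+ 2) <= 1.
Proof.
move=> /andP[k0 k1].
have s1 : sin x ^+ 2 <= 1 by have := cos2Dsin2 x; have := sqr_ge0 (cos x); lra.
have k2 : k ^+ 2 < 1 by rewrite expr_lt1.
have D : 0 < 1 - (k * sin x) ^+ 2.
  by rewrite exprMn; have := sqr_ge0 k; have := sqr_ge0 (sin x); nra.
rewrite ler_pdivrMr ?sqrtr_gt0// mul1r (le_trans (ler_norm _))//.
rewrite -sqrtr_sqr ler_wsqrtr// !exprMn cos2sin2.
by have := sqr_ge0 k; have := sqr_ge0 (sin x); nra.
Qed.

(** The derivative is at most 1 because k^2 cos^2 <= 1 - k^2 sin^2. Geometrically, at a fixed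
    dihedral angle, what the shrinking second diagonal adds to the curvature never exceeds what the
    growing first diagonal removes. *)
Lemma asin_sin_lip k x y : 0 <= k <= 1 -> 0 <= x -> x <= y -> y <= pi / 2 ->
  asin (k * sin y) - asin (k * sin x) <= y - x.
Proof.
move=> /andP[k0 k1] x0 xy y2; have p0 := @pi_gt0 R.
(* At k = 1 the denominator of the derivative vanishes at pi / 2; the function is then the identity
   on [0, pi / 2]. *)
have [->|k1'] := eqVneq k 1.
  by rewrite !mul1r !sinK ?in_itv//=; apply/andP; split; lra.
have k01 : 0 <= k < 1 by rewrite k0 lt_neqAle k1'.
have [c _ ->] := MVT_deriv xy (fun z => is_derive_asin_sin z k01).
by apply: ler_piMl; rewrite ?subr_ge0// deriv_asin_sin_le1.
Qed.

(* [a |-> asin (k * sin a)] is concave on [0, pi / 2] and vanishes at 0. *)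
Lemma asin_sin_ratio k x y : 0 <= k < 1 -> 0 <= x -> x <= y -> y <= pi / 2 ->
  x * asin (k * sin y) <= y * asin (k * sin x).
Proof.
move=> k01 x0 xy y2; have /andP[k0 k1] := k01; have p0 := @pi_gt0 R.
have D z := is_derive_asin_sin z k01.
have [c /andP[c0 cx]] := MVT_deriv x0 D.
have [d /andP[xd dy]] := MVT_deriv xy D.
rewrite sin0 mulr0 asin0 !subr0.
set gd := _ / Num.sqrt _; set gc := _ / Num.sqrt _ => gdE gcE.
have gdc : gd <= gc.
  have ss : sin c <= sin d.
    rewrite leNgt ltr_sin ?in_itv/= -?leNgt; lra.
  have cc : 0 <= cos d by apply: cos_ge0_pihalf; lra.
  have cc' : 0 <= cos c by apply: cos_ge0_pihalf; lra.
  have sc0 : 0 <= sin c by apply: sin_ge0_pihalf; lra.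
  have s1 (z : R) : sin z ^+ 2 <= 1.
    by have := cos2Dsin2 z; have := sqr_ge0 (cos z); lra.
  have k2 : k ^+ 2 < 1 by rewrite expr_lt1.
  have Dp z : 0 < 1 - (k * sin z) ^+ 2.
    rewrite exprMn; have := s1 z; have := sqr_ge0 k; have := sqr_ge0 (sin z).
    by nra.
  rewrite /gd /gc ler_pdivrMr ?sqrtr_gt0// mulrAC ler_pdivlMr ?sqrtr_gt0//.
  rewrite -!mulrA ler_wpM2l//.
  rewrite -(ger0_norm cc) -(ger0_norm cc') -!sqrtr_sqr -!sqrtrM ?sqr_ge0//.
  rewrite ler_wsqrtr// !exprMn !cos2sin2.
  have ss2 : sin c ^+ 2 <= sin d ^+ 2 by rewrite ler_sqr// nnegrE; lra.
  have : 0 <= (sin d ^+ 2 - sin c ^+ 2) * (1 - k ^+ 2).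
    by rewrite mulr_ge0//; lra.
  by lra.
have -> : asin (k * sin y) = asin (k * sin x) + gd * (y - x) by rewrite -gdE; ring.
rewrite gcE; have : x * (gd * (y - x)) <= x * (gc * (y - x)).
  by rewrite ler_wpM2l// ler_wpM2r// subr_ge0.
lra.
Qed.

Lemma asin_ratio k z w : 0 <= k < 1 -> 0 <= z -> z <= w -> w <= 1 ->
  asin z * asin (k * w) <= asin w * asin (k * z).
Proof.
move=> k01 z0 zw w1.
have := @asin_sin_ratio k (asin z) (asin w) k01.
rewrite !asinK ?in_itv/=; [|lra..]; apply; first by apply: asin_ge0; lra.
  by apply: ler_asin => //; lra.
by apply: asin_lepi2; lra.
Qed.

(** This is sin x <= x at x = pi / 6. The bound feeds the numerical comparison at sqrt 2. *)
Lemma pi_ge3 : 3 <= pi :> R.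
Proof.
suff s6 : sin (pi / 6) = 2^-1 :> R.
  have p0 := @pi_gt0 R; have : sin (pi / 6) <= pi / 6 :> R by apply: sin_le; lra.
  by rewrite s6; lra.
have p0 := @pi_gt0 R.
have s0 : 0 < sin (pi / 6) :> R by apply: sin_gt0_pi; lra.
have : sin (pi / 2) = 1 :> R := sin_pihalf R.
have -> : pi / 2 = pi / 6 *+ 2 + pi / 6 :> R by rewrite mulr2n; field.
rewrite sinD sin_mulr2n cos_mulr2n.
have := cos2Dsin2 (pi / 6 : R); set s := sin _ in s0 *; set c := cos _ => cs E.
(* [E] is the triple-angle identity 3 s - 4 s^3 = 1, and 4 s^3 - 3 s + 1 has this factorization. *)
have : (s + 1) * (2 * s - 1) ^+ 2 = 0.
  have c2 : c ^+ 2 = 1 - s ^+ 2 by lra.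
  move: E; rewrite !mulr2n c2 => E; rewrite -(subrr 1) -[X in _ = _ - X]E; ring: c2.
move/eqP; rewrite mulf_eq0 sqrf_eq0 => /orP[|] /eqP; lra.
Qed.

(** On [0, asin x] the slope of sin is at least cos (asin x) = sqrt(1 - x^2) >= 1 / sqrt 2, so the
    mean value theorem bounds x below by asin x / sqrt 2. *)
Lemma asin_le_sqrt2 x : 0 <= x <= (Num.sqrt 2)^-1 -> asin x <= Num.sqrt 2 * x.
Proof.
have s2 : Num.sqrt 2 ^+ 2 = 2 :> R by rewrite sqr_sqrtr.
have s0 : 0 < Num.sqrt 2 :> R by rewrite sqrtr_gt0.
have i2 : (Num.sqrt 2)^-1 * (Num.sqrt 2)^-1 = 2^-1 :> R by rewrite -invfM -expr2 s2.
have i0 : 0 < (Num.sqrt 2)^-1 :> R by rewrite invr_gt0.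
have i1 : (Num.sqrt 2)^-1 <= 1 :> R by nra.
have is2 : (Num.sqrt 2)^-1 * Num.sqrt 2 = 1 :> R by rewrite mulVf// gt_eqF.
move=> /andP[x0 xs].
have a0 : 0 <= asin x by apply: asin_ge0; lra.
have [c /andP[c0 ca]] := MVT_deriv a0 (@is_derive_sin R).
rewrite sin0 asinK ?in_itv/= ?subr0; last by lra.
have x1 : x <= 1 by lra.
have x2 : x ^+ 2 <= 2^-1 by rewrite expr2 -i2; nra.
have a2 : asin x <= pi / 2 by apply: asin_lepi2; lra.
have p0 := @pi_gt0 R.
have cc : (Num.sqrt 2)^-1 <= cos c.
  have -> : (Num.sqrt 2)^-1 = Num.sqrt (2^-1) :> R by rewrite sqrtrV.
  apply: le_trans (_ : cos (asin x) <= _).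
    by rewrite cos_asin ?ler_wsqrtr//; lra.
  rewrite leNgt ltr_cos ?in_itv/= -?leNgt; lra.
move=> xE; rewrite -ler_pdivrMl// [leRHS]xE.
by rewrite ler_wpM2r.
Qed.

End Trigonometry.

(** * The symmetric density of the pair of diagonals *)

Section LawOfDiagonals.
Variable R : realType.
Local Notation lambda := (@lebesgue_measure R).

Lemma integral_is_derive (f F : R -> R) (a b : R) : a <= b ->
  (forall x, a <= x <= b -> {for x, continuous f}) ->
  (forall x, a <= x <= b -> is_derive x 1 F (f x)) ->
  (\int[lambda]_(x in `[a, b]) (f x)%:E = (F b - F a)%:E)%E.
Proof.
move=> ab cf dF; move: (ab); rewrite le_eqVlt => /predU1P[<-|{}ab].
  by rewrite set_itv1 integral_set1 subrr.
have cF x : a <= x <= b -> {for x, continuous F}.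
  by move=> /dF[dFx _]; exact/differentiable_continuous/derivable1_diffP.
have oo_cc x : x \in `]a, b[ -> a <= x <= b.
  by rewrite in_itv/= => /andP[/ltW -> /ltW ->].
rewrite EFinB; apply: continuous_FTC2 => //.
- by apply: continuous_in_subspaceT => x; rewrite inE/= in_itv => /cf.
- split.
  + by move=> x /oo_cc/dF[].
  + by apply: cvg_at_right_filter; apply: cF; rewrite lexx ltW.
  + by apply: cvg_at_left_filter; apply: cF; rewrite lexx ltW.
- by move=> x /oo_cc/dF dFx; rewrite derive1E derive_val.
Qed.

Lemma is_derive_acos_div (c y : R) : 0 < c -> -c < y < c ->
  is_derive y 1 (fun z => - 4 * acos (z / c)) (4 * (Num.sqrt (c ^+ 2 - y ^+ 2))^-1).
Proof.
move=> c0 yc.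
have yc1 : -1 < y / c < 1.
  by rewrite ltr_pdivlMr// ltr_pdivrMr// mulN1r mul1r.
have dd : is_derive y 1 (fun z => z / c) c^-1.
  by apply: is_derive_eq; rewrite ?scaler0 ?add0r ?scaler1 ?mulr1.
have := @is_derive1_comp R (@acos R) (fun z => z / c) y _ _ (is_derive1_acos yc1) dd.
move=> da; have -> : 4 * (Num.sqrt (c ^+ 2 - y ^+ 2))^-1 =
  - 4 * (- (Num.sqrt (1 - (y / c) ^+ 2))^-1 / c).
  rewrite !mulNr mulrN opprK -invfM; congr (_ * _^-1).
  rewrite -{3}(ger0_norm (ltW c0)) -sqrtr_sqr -sqrtrM; last first.
    rewrite subr_ge0 -real_normK ?num_real// expr_le1// ler_norml; lra.
  by congr Num.sqrt; field; rewrite gt_eqF.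
exact: is_deriveZ.
Qed.

Lemma measurable_sqrtrV : measurable_fun [set: R] (fun x => (Num.sqrt x)^-1).
Proof.
have -> : (fun x => (Num.sqrt x)^-1) = (fun x => powR (Num.sqrt x) (-1)) :> (R -> R).
  by apply/funext => x; rewrite powR_inv1// sqrtr_ge0.
apply: (@measurableT_comp _ _ _ _ _ _ (@powR R ^~ (-1))) => //.
exact: continuous_measurable_fun (@sqrt_continuous R).
Qed.

Lemma integral_arcsine_density (b c : R) : 0 <= b < c ->
  (\int[lambda]_(y in `]b, c[) (4 * (Num.sqrt (c ^+ 2 - y ^+ 2))^-1)%:E
    = (4 * acos (b / c))%:E)%E.
Proof.
move=> /andP[b0 bc]; have c0 : 0 < c by exact: le_lt_trans bc.
set f := fun y : R => 4 * (Num.sqrt (c ^+ 2 - y ^+ 2))^-1.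
have bc1 : -1 <= b / c < 1.
  by rewrite ler_pdivlMr// ltr_pdivrMr// mulN1r mul1r; apply/andP; split; lra.
have mf : measurable_fun [set: R] f.
  apply: measurable_funM => //; apply: (measurableT_comp measurable_sqrtrV).
  by apply: measurable_funB => //; exact: measurable_funX.
(* The integrand is unbounded near [c]: exhaust [b, c[ by the intervals
   [b, c * cos (delta / n.+1)]. *)
set delta := acos (b / c).
have d0 : 0 < delta by exact: acos_gt0.
have dp : delta <= pi by apply: acos_lepi; have /andP[-> /ltW] := bc1.
pose e n := delta / n.+1%:R.
have e0 n : 0 < e n by rewrite divr_gt0.
have ed n : e n <= delta by rewrite ler_pdivrMr// ler_peMr ?ler1n// ltW.
have e_cvg : e n @[n --> \oo] --> (0 : R).
  by rewrite -(mulr0 delta); apply: cvgM; [exact: cvg_cst | exact: cvg_harmonic].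
pose z n := c * cos (e n).
have zc n : z n < c.
  rewrite gtr_pMr// -cos0 ltr_cos ?in_itv/= ?lexx ?pi_ge0//.
  by rewrite (ltW (e0 n)) (le_trans (ed n)).
have bz n : b <= z n.
  rewrite /z mulrC -ler_pdivrMr// -(@acosK _ (b / c)) ?in_itv/=; last first.
    by have /andP[-> /ltW] := bc1.
  rewrite leNgt ltr_cos ?in_itv/= -/delta ?(ltW d0)// ?(ltW (e0 n))//=.
  - by rewrite -leNgt.
  - by rewrite (le_trans (ed n)).
pose F n := `[b, z n]%classic.
have FE : `[b, c[%classic = \bigcup_n F n.
  apply/seteqP; split=> y /=; last first.
    case=> n _; rewrite /F/= !in_itv/= => /andP[-> /le_lt_trans]; apply.
    exact: zc.
  rewrite in_itv/= => /andP[by_ yc].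
  have yc1 : -1 <= y / c < 1.
    by rewrite ler_pdivlMr// ltr_pdivrMr// mulN1r mul1r; apply/andP; split; lra.
  have a0 : 0 < acos (y / c) by exact: acos_gt0.
  have [n _ /(_ n (leqnn n)) en] : \forall n \near \oo, e n < acos (y / c).
    by move/cvgr_lt : e_cvg; apply.
  exists n => //; rewrite /F/= in_itv/= by_ /=.
  rewrite /z mulrC -ler_pdivrMr// -(@acosK _ (y / c)) ?in_itv/=; last first.
    by have /andP[-> /ltW] := yc1.
  rewrite leNgt ltr_cos ?in_itv/= ?(ltW a0)// ?(ltW (e0 n))//=.
  - by rewrite -leNgt ltW.
  - by apply: acos_lepi; have /andP[-> /ltW] := yc1.
  - by rewrite (le_trans (ed n)).
have intF n : (\int[lambda]_(y in F n) (f y)%:E = (4 * (delta - e n))%:E)%E.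
  pose G (y : R) := - 4 * acos (y / c).
  transitivity (G (z n) - G b)%:E; last first.
    rewrite /G; congr EFin; rewrite -/delta /z [c * _ / c]mulrAC divff ?gt_eqF// mul1r.
    rewrite cosK; first by ring.
    by rewrite in_itv/= (ltW (e0 n)) (le_trans (ed n)).
  have cf y : b <= y <= z n -> {for y, continuous f}.
    move=> /andP[by_ yz]; rewrite /f.
    have yc : y < c by exact: le_lt_trans (zc n).
    have D : 0 < c ^+ 2 - y ^+ 2.
      by rewrite subr_gt0 ltr_pXn2r// nnegrE; lra.
    apply: cvgM; first exact: cvg_cst.
    apply: cvgV; first by rewrite gt_eqF// sqrtr_gt0.
    apply: continuous_comp; last exact: sqrt_continuous.
    by apply: cvgB; [exact: cvg_cst | exact: exprn_continuous].
  have df y : b <= y <= z n -> is_derive y 1 G (f y).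
    move=> /andP[by_ yz]; apply: is_derive_acos_div => //.
    by have := zc n; lra.
  exact: (integral_is_derive (bz n) cf df).
rewrite integral_itv_obnd_cbnd; last first.
  by apply/measurable_EFinP; exact: measurable_funTS.
have cvgF : (\int[lambda]_(y in F n) (f y)%:E @[n --> \oo] -->
    \int[lambda]_(y in \bigcup_n F n) (f y)%:E)%E.
  apply: ge0_nondecreasing_set_cvg_integral => //.
  - move=> m n mn; apply/subsetPset; apply: subset_itvl; rewrite bnd_simp /z.
    rewrite ler_pM2l// leNgt ltr_cos ?in_itv/= ?(ltW (e0 _))//=.
    + by rewrite -leNgt ler_pM2l// lef_pV2 ?posrE// ler_nat.
    + by rewrite (le_trans (ed _)).
    + by rewrite (le_trans (ed _)).
  - by move=> i; exact: measurable_itv.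
  - by move=> i; apply/measurable_EFinP; exact: measurable_funTS.
  - by move=> i y _; rewrite lee_fin mulr_ge0// invr_ge0 sqrtr_ge0.
rewrite FE; apply/esym/(cvg_unique _ _ cvgF); first exact: ereal_hausdorff.
rewrite (_ : (fun n => _) = (fun n => (4 * (delta - e n))%:E)); last first.
  by apply/funext => n; rewrite -intF.
apply: cvg_EFin; first exact: nearW.
have : 4 * (delta - e n) @[n --> \oo] --> 4 * (delta - 0).
  by apply: cvgM; [exact: cvg_cst | apply: cvgB; [exact: cvg_cst | exact: e_cvg]].
by rewrite subr0.
Qed.
End LawOfDiagonals.

(** * Area of the sphere of radius 2 in terms of two coordinates *)

Section SphereDensity.
Variable R : realType.
Local Notation lambda := (@lebesgue_measure R).

Lemma sin_gt_sin (a t : R) : 0 <= a <= pi / 2 -> 0 <= t <= pi ->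
  (sin a < sin t) = (a < t < pi - a).
Proof.
move=> /andP[a0 a2] /andP[t0 tp]; have p0 := @pi_gt0 R.
have [t2|t2] := leP t (pi / 2).
  rewrite ltr_sin ?in_itv/=; [|lra|lra].
  by apply/idP/andP => [at_|[]//]; split=> //; lra.
have -> : sin t = sin (pi - t) by rewrite sinB sinpi cospi; ring.
rewrite ltr_sin ?in_itv/=; [|lra|lra].
by apply/idP/andP => [at_|[]]; [split|]; lra.
Qed.

(** Replacing a negative b by 0 keeps the formula right: the condition then holds on the whole
    interval, and 4 acos 0 = 2 pi is its length. *)
Lemma measure_sin_half_gt (b c : R) : 0 < c ->
  lambda (`[0, 2 * pi[ `&` [set t | b < c * sin (t / 2)]) =
  (if Num.max b 0 < c then (4 * acos (Num.max b 0 / c))%:E else 0%E).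
Proof.
move=> c0; have p0 := @pi_gt0 R.
have [b0|b0] := ltP b 0.
  rewrite c0 mul0r acos0 setIidl; last first.
    move=> t /=; rewrite in_itv/= => /andP[t0 t2].
    apply: (lt_le_trans b0); apply: mulr_ge0; first exact: ltW.
    by apply: sin_ge0_pi; lra.
  rewrite lebesgue_measure_itv/= lte_fin ifT; last by rewrite mulr_gt0.
  by rewrite -EFinB; congr EFin; field.
have [bc|cb] := ltP b c; last first.
  rewrite (_ : _ `&` _ = set0) ?measure0//; apply/seteqP; split=> // t [_ /=].
  rewrite ltNge => /negP; apply; apply: le_trans cb.
  by apply: ler_piMr; [exact: ltW|exact: sin_le1].
have bc1 : -1 <= b / c <= 1.
  by rewrite ler_pdivlMr// ler_pdivrMr// mulN1r mul1r; apply/andP; split; lra.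
have bc0 : 0 <= b / c by rewrite divr_ge0// ltW.
have bc2 : -1 <= b / c < 1.
  by rewrite ler_pdivlMr// ltr_pdivrMr// mulN1r mul1r; apply/andP; split; lra.
have a2 : asin (b / c) < pi / 2 by exact: asin_ltpi2.
have a0 : 0 <= asin (b / c) by apply: asin_ge0; rewrite bc0; case/andP: bc1.
rewrite (_ : _ `&` _ = `]2 * asin (b / c), 2 * pi - 2 * asin (b / c)[%classic).
  rewrite lebesgue_measure_itv/= lte_fin ifT; last by lra.
  by rewrite -EFinB asin_acos//; congr EFin; field.
have E t : 0 <= t < 2 * pi -> (b < c * sin (t / 2)) =
    (asin (b / c) < t / 2 < pi - asin (b / c)).
  move=> t02; rewrite mulrC -ltr_pdivrMr// -[X in X < _](asinK bc1) sin_gt_sin//; lra.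
apply/seteqP; split=> t /=; rewrite !in_itv/=.
  by move=> [t02]; rewrite E//; lra.
move=> tab; have t02 : 0 <= t < 2 * pi by lra.
by split => //; rewrite E//; lra.
Qed.

(** On the sphere of radius 2, with height x and longitude theta / 2, the area element is dx dtheta.
    The area density over the (x, y)-plane is 2 / sqrt(4 - x^2 - y^2), doubled because both signs of
    the third coordinate occur. Outside the disc of radius 2 the root of a negative number and the
    inverse of 0 are both 0, so the support needs no separate condition. *)
Definition sphere_density (x y : R) : R :=
  if (0 < x) && (0 < y) then 4 * (Num.sqrt (4 - x ^+ 2 - y ^+ 2))^-1 else 0.

Lemma sphere_densityC x y : sphere_density x y = sphere_density y x.
Proof. by rewrite /sphere_density andbC addrAC. Qed.

Lemma sphere_density_ge0 x y : 0 <= sphere_density x y.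
Proof.
by rewrite /sphere_density; case: ifP => // _; rewrite mulr_ge0 ?invr_ge0 ?sqrtr_ge0.
Qed.

Lemma measurable_sphere_density :
  measurable_fun [set: measurableTypeR R * measurableTypeR R]
    (fun p => sphere_density p.1 p.2).
Proof.
apply: measurable_fun_ifT => //.
  by apply: measurable_and; apply: measurable_fun_ltr.
apply: measurable_funM => //.
apply: (measurableT_comp (@measurable_sqrtrV R)).
apply: measurable_funB; last exact: measurable_funX.
by apply: measurable_funB => //; exact: measurable_funX.
Qed.

Lemma integral_sphere_density (x b : R) : 0 < x < 2 ->
  (\int[lambda]_(y in `]b, +oo[) (sphere_density x y)%:E)%E =
  lambda (`[0, 2 * pi[ `&` [set t | (b < Num.sqrt (4 - x ^+ 2) * sin (t / 2))%R]).
Proof.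
move=> /andP[x0 x2]; have D : 0 < 4 - x ^+ 2.
  by rewrite subr_gt0 (_ : 4 = 2 ^+ 2) ?ltr_pXn2r ?nnegrE//; [lra|ring].
set c := Num.sqrt _; have c0 : 0 < c by rewrite sqrtr_gt0.
have c2 : c ^+ 2 = 4 - x ^+ 2 by rewrite sqr_sqrtr// ltW.
rewrite measure_sin_half_gt//; set b' := Num.max b 0.
have b0 : 0 <= b' by rewrite /b' le_max lexx orbT.
have bb : b <= b' by rewrite /b' le_max lexx.
pose f (y : R) := 4 * (Num.sqrt (c ^+ 2 - y ^+ 2))^-1.
transitivity (\int[lambda]_(y in `]b', c[) (f y)%:E)%E.
  rewrite [RHS](_ : _ = \int[lambda]_(y in `]b, +oo[ `&` `]b', c[) (f y)%:E)%E.
    rewrite integral_mkcondr; apply: eq_integral => y.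
    rewrite inE/= in_itv/= andbT => by_; rewrite patchE /sphere_density x0/= -c2.
    case: ifPn => y0; case: ifPn; rewrite ?inE/= ?notin_setE/= ?in_itv/= => yc //.
    - congr EFin; apply/eqP; rewrite mulf_eq0 invr_eq0 sqrtr_eq0; apply/orP; right.
      rewrite subr_le0 ler_pXn2r ?nnegrE ?(ltW c0) ?(ltW y0)//.
      by rewrite leNgt; apply/negP => ycc; apply: yc; rewrite ycc andbT gt_max by_.
    - by move: yc; rewrite gt_max (negbTE y0) andbF.
  congr (integral _ _ _); apply/seteqP; split=> y /=; rewrite ?in_itv/=; last by case.
  by move=> /andP[by_ yc]; rewrite by_ yc (le_lt_trans bb).
case: ifPn => bc; first by rewrite integral_arcsine_density// b0.
by rewrite set_itv_ge ?integral_set0// bnd_simp.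
Qed.
End SphereDensity.

(** * Exchanging the two diagonals preserves the volume *)

Section SwapInvariance.
Variable R : realType.
Local Notation lambda := (@lebesgue_measure R).
Local Notation aa_volume := (mrestr (lambda \x lambda)%E (@measurable_aa_domain R)).

Definition second_diagonal (p : aa_coord R) : R :=
  Num.sqrt (4 - p.1 ^+ 2) * sin (p.2 / 2).

Definition diagonals (p : aa_coord R) : aa_coord R := (p.1, second_diagonal p).

Lemma measurable_second_diagonal : measurable_fun [set: aa_coord R] second_diagonal.
Proof.
apply: measurable_funM.
  apply: (measurableT_comp (continuous_measurable_fun (@sqrt_continuous R))).
  by apply: measurable_funB => //; exact: measurable_funX.
apply: (measurableT_comp (continuous_measurable_fun (@continuous_sin R))).
exact: measurable_funM.
Qed.

Lemma measurable_diagonals : measurable_fun [set: aa_coord R] diagonals.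
Proof.
by apply: measurable_fun_pair => //; exact: measurable_second_diagonal.
Qed.

(** Open quadrants are stable under intersection, so this makes them a family on which equality of
    two finite measures may be tested. A half-plane is the union of the quadrants whose other bound
    is -n. *)
Lemma measurable_rays : @measurable _ (aa_coord R) =
  <<s [set A | exists a b : R, A = `]a, +oo[ `*` `]b, +oo[ ] >>.
Proof.
set G := [set A | _]; rewrite eqEsubset; split; last first.
  apply: smallest_sub; first exact: sigma_algebra_measurable.
  by move=> _ [a [b ->]]; apply: measurableX; exact: measurable_itv.
have rayT (x : R) : exists n : nat, - n%:R < x.
  exists (Num.truncn `|x|).+1; rewrite ltrNl (le_lt_trans _ (truncnS_gt _))//.
  by rewrite -normrN ler_norm.
pose T' := g_sigma_algebraType G.
have m1 : measurable_fun [set: T'] (fst : T' -> measurableTypeR R).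
  apply: (measurability (@RGenOInfty.G R)); first exact: RGenOInfty.measurableE.
  move=> _ [_ [a ->] <-]; rewrite setTI.
  have -> : (fst : T' -> measurableTypeR R) @^-1` `]a, +oo[ =
      \bigcup_n (`]a, +oo[ `*` `]- n%:R, +oo[) :> set T'.
    apply/seteqP; split=> [[x y] /= ax|[x y] [n _ []]//].
    by have [n yn] := rayT y; exists n => //; split=> //=; rewrite in_itv/= yn.
  apply: bigcupT_measurable => n; apply: sub_sigma_algebra.
  by exists a, (- n%:R).
have m2 : measurable_fun [set: T'] (snd : T' -> measurableTypeR R).
  apply: (measurability (@RGenOInfty.G R)); first exact: RGenOInfty.measurableE.
  move=> _ [_ [a ->] <-]; rewrite setTI.
  have -> : (snd : T' -> measurableTypeR R) @^-1` `]a, +oo[ =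
      \bigcup_n (`]- n%:R, +oo[ `*` `]a, +oo[) :> set T'.
    apply/seteqP; split=> [[x y] /= ay|[x y] [n _ []]//].
    by have [n xn] := rayT x; exists n => //; split=> //=; rewrite in_itv/= xn.
  apply: bigcupT_measurable => n; apply: sub_sigma_algebra.
  by exists (- n%:R), a.
move=> A mA; have := measurable_fun_pair m1 m2 measurableT mA.
by rewrite setTI => mA'; have <- : (fun x => (x.1, x.2)) @^-1` A = A
  by apply/seteqP; split => -[].
Qed.

Lemma aa_volume_diagonals_rays (a b : R) :
  aa_volume (diagonals @^-1` (`]a, +oo[ `*` `]b, +oo[)) =
  (\int[lambda]_(x in `]a, +oo[) \int[lambda]_(y in `]b, +oo[)
     (sphere_density x y)%:E)%E.
Proof.
rewrite /mrestr/= /product_measure1 [RHS]integral_mkcond; apply: eq_integral => x _.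
rewrite patchE; case: ifPn; rewrite ?notin_setE ?inE/= ?in_itv/= andbT => ax; last first.
  rewrite (_ : xsection _ _ = set0) ?measure0//; apply/seteqP; split=> // t.
  by rewrite /xsection/= inE => -[[]] /=; rewrite in_itv/= andbT.
have [x02|x02] := boolP (0 < x < 2).
  rewrite integral_sphere_density//; congr (lambda _); apply/seteqP; split=> t.
    by rewrite /xsection/= inE /aa_domain/= !in_itv/= => -[[_ /=]]; rewrite andbT => ? [].
  rewrite /xsection/= inE /aa_domain/= !in_itv/= => -[t2 bt].
  by split; split => //=; rewrite !andbT.
rewrite (_ : xsection _ _ = set0) ?measure0; last first.
  apply/seteqP; split=> // t; rewrite /xsection/= inE /aa_domain/= => -[_ [/=]].
  by rewrite in_itv/= (negbTE x02).
apply/esym/integral0_eq => y _; rewrite /sphere_density; case: ifP => // /andP[x0 y0].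
have x2 : 2 <= x by move: x02; rewrite x0/= -leNgt.
congr EFin; apply/eqP; rewrite mulf_eq0 invr_eq0 sqrtr_eq0; apply/orP; right.
by have := sqr_ge0 y; nra.
Qed.

Lemma aa_volume_fin : (aa_volume [set: aa_coord R] < +oo)%E.
Proof.
rewrite /mrestr setTI /aa_domain product_measure1E//=; [|exact: measurable_itv..].
rewrite !lebesgue_measure_itv/= !lte_fin; do 2 case: ifP => _;
  by rewrite ?mule0 ?mul0e ?ltry// -EFinM ltry.
Qed.

(* Archimedes: in the coordinates [(l, d)], the measure [dl dtheta] has the
   symmetric density [sphere_density]. *)
Lemma aa_volume_swap (A : set (aa_coord R)) : measurable A ->
  aa_volume (diagonals @^-1` A) =
  aa_volume ((fun p => ((diagonals p).2, (diagonals p).1)) @^-1` A).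
Proof.
pose swap := fun p : aa_coord R => ((diagonals p).2, (diagonals p).1) : aa_coord R.
have mswap : measurable_fun setT swap.
  apply: measurable_fun_pair; [exact: measurable_second_diagonal|exact: measurable_fst].
pose m1 := measure_function_pushforward__canonical__measure_function_Measure
  aa_volume measurable_diagonals.
pose m2 := measure_function_pushforward__canonical__measure_function_Measure
  aa_volume mswap.
move=> mA; change (m1 A = m2 A).
have fin1 B : measurable B -> (m1 B < +oo)%E.
  move=> mB; apply: le_lt_trans aa_volume_fin.
  apply: (@le_measure _ _ _ aa_volume (diagonals @^-1` B)); rewrite ?inE//.
  by rewrite -[X in measurable X]setTI; exact: measurable_diagonals.
pose G := [set A | exists a b : R, A = `]a, +oo[ `*` `]b, +oo[ ] : set (set (aa_coord R)).
(* On a quadrant both image measures are double integrals of [sphere_density]; exchanging the order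
   of integration and the two arguments of the density turns one into the other. *)
apply: (measure_unique G (fun n => `]- n%:R, +oo[ `*` `]- n%:R, +oo[)) => //.
- exact: measurable_rays.
- move=> _ _ [a [b ->]] [c [d ->]]; exists (Num.max a c), (Num.max b d).
  rewrite -setXI; congr (_ `*` _); apply/seteqP;
    by split=> x /=; rewrite !in_itv/= !andbT gt_max => /andP.
- by move=> n; exists (- n%:R), (- n%:R).
- apply/seteqP; split=> // -[x y] _.
  exists (Num.truncn (Num.max `|x| `|y|)).+1 => //=; rewrite !in_itv/= !andbT.
  have h : Num.max `|x| `|y| < (Num.truncn (Num.max `|x| `|y|)).+1%:R by exact: truncnS_gt.
  split; rewrite ltrNl (le_lt_trans (ler_norm _))// normrN;
    by apply: le_lt_trans h; rewrite le_max lexx ?orbT.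
- move=> _ [a [b ->]] /=; rewrite /pushforward.
  rewrite (_ : swap @^-1` _ = diagonals @^-1` (`]b, +oo[ `*` `]a, +oo[)); last first.
    by apply/seteqP; split=> -[x y] [].
  rewrite !aa_volume_diagonals_rays.
  pose h (p : aa_coord R) := ((sphere_density p.1 p.2)%:E *
    ((\1_(`]a, +oo[ : set R) p.1)%:E * (\1_(`]b, +oo[ : set R) p.2)%:E))%E.
  have mh : measurable_fun setT h.
    apply: emeasurable_funM.
      by apply/measurable_EFinP; exact: measurable_sphere_density.
    apply: emeasurable_funM; apply/measurable_EFinP.
      by apply: measurableT_comp => //; exact: measurable_indic.
    by apply: measurableT_comp => //; exact: measurable_indic.
  have h0 p : (0 <= h p)%E.
    by rewrite !mule_ge0 ?lee_fin ?sphere_density_ge0.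
  transitivity (\int[lambda]_x \int[lambda]_y h (x, y))%E.
    rewrite integral_mkcond; apply: eq_integral => x _; rewrite patchE/=.
    case: ifPn => xa.
      rewrite integral_mkcond; apply: eq_integral => y _; rewrite patchE /h/= !indicE xa.
      by case: ifPn => _; rewrite !(mul1e, mule1, mule0).
    rewrite -[LHS](@integral0 _ _ _ lambda setT); apply: eq_integral => y _.
    by rewrite /h/= indicE (negbTE xa) mul0e mule0.
  rewrite (fubini_tonelli h)//; apply/esym.
  rewrite integral_mkcond; apply: eq_integral => y _; rewrite patchE/=.
  case: ifPn => yb.
    rewrite integral_mkcond; apply: eq_integral => x _; rewrite patchE /h/= !indicE yb.
    by rewrite sphere_densityC; case: ifPn => _; rewrite !(mul1e, mule1, mule0).
  rewrite -[LHS](@integral0 _ _ _ lambda setT); apply: eq_integral => x _.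
  by rewrite /h/= !indicE (negbTE yb) !mule0.
- move=> n; apply: fin1; apply: measurableX; exact: measurable_itv.
Qed.
End SwapInvariance.

(** * Integrals over the action-angle domain *)

Section Disintegration.
Variable R : realType.
Local Notation lambda := (@lebesgue_measure R).
Local Notation mu := (lambda \x lambda)%E.
Local Notation aa_volume := (mrestr mu (@measurable_aa_domain R)).
Local Open Scope ereal_scope.

Lemma ge0_integral_mrestr d (T : measurableType d) (m : {measure set T -> \bar R})
    (D E : set T) (mD : measurable D) (f : T -> \bar R) :
  measurable E -> measurable_fun E f -> (forall x, E x -> 0 <= f x) ->
  \int[mrestr m mD]_(x in E) f x = \int[m]_(x in E `&` D) f x.
Proof.
move=> mE mf f0.
have mED : measurable (E `&` D) by exact: measurableI.
have mEC : measurable (E `\` D) by exact: measurableD.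
rewrite -{1}(setUIDK E D) ge0_integral_setU//; last 3 first.
- by rewrite setUIDK.
- by rewrite setUIDK.
- by apply/disj_set2P; rewrite setDE setIACA setICr setI0.
rewrite [X in _ + X](_ : _ = 0) ?adde0; last first.
  apply: null_set_integral => //; first exact: measurable_funS mf.
  by rewrite /= /mrestr setDE -setIA setICl setI0 measure0.
rewrite (@eq_measure_integral _ _ _ _ m)// => A mA AED.
by rewrite /= /mrestr setIidl// => x /AED[].
Qed.

Lemma ge0_integral_aa_domain (H : aa_coord R -> \bar R) :
  measurable_fun setT H -> (forall p, 0 <= H p) ->
  \int[mu]_(p in @aa_domain R) H p =
  \int[lambda]_(x in `]0%R, 2%R[) \int[lambda]_(t in `[0%R, (2 * pi)%R[) H (x, t).
Proof.
move=> mH H0; rewrite integral_mkcond.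
have mHD : measurable_fun setT (H \_ (@aa_domain R)).
  have [h _] := measurable_restrictT H (@measurable_aa_domain R).
  by apply: h; exact: measurable_funS mH.
rewrite (fubini_tonelli1 (m1 := lambda) (m2 := lambda) (H \_ (@aa_domain R)) mHD);
  last by move=> p; rewrite patchE; case: ifP.
rewrite /fubini_F.
rewrite [RHS]integral_mkcond; apply: eq_integral => x _; rewrite patchE.
case: ifPn => x02.
  rewrite [RHS]integral_mkcond; apply: eq_integral => t _; rewrite !patchE.
  by rewrite /aa_domain in_setX/= x02.
rewrite -[RHS](@integral0 _ _ _ lambda setT); apply: eq_integral => t _.
by rewrite patchE /aa_domain in_setX/= (negbTE x02).
Qed.

(** Both sides are integrals of [F] against the two image measures identified by [aa_volume_swap].
    All later uses of the symmetry go through this form. *)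
Lemma ge0_integral_swap (F : aa_coord R -> \bar R) :
  measurable_fun setT F -> (forall p, 0 <= F p) ->
  \int[mu]_(p in @aa_domain R) F (p.1, second_diagonal p) =
  \int[mu]_(p in @aa_domain R) F (second_diagonal p, p.1).
Proof.
move=> mF F0.
pose swap := fun p : aa_coord R => (second_diagonal p, p.1) : aa_coord R.
have mswap : measurable_fun setT swap.
  by apply: measurable_fun_pair; [exact: measurable_second_diagonal|exact: measurable_fst].
have E (f : aa_coord R -> aa_coord R) : measurable_fun setT f ->
    \int[mu]_(p in @aa_domain R) F (f p) = \int[pushforward aa_volume f]_p F p.
  move=> mf; apply/esym.
  have /= -> := @ge0_integral_pushforward _ _ _ _ _ _ mf aa_volume _ _
    measurableT mF (fun p _ => F0 p).
  rewrite preimage_setT -[X in _ = integral _ X _](setTI (@aa_domain R)).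
  apply: (@ge0_integral_mrestr _ _ mu _ _ (@measurable_aa_domain R)) => //.
  exact: measurableT_comp.
rewrite (E _ (@measurable_diagonals R)) (E _ mswap).
apply: eq_measure_integral; first exact: measurable_diagonals.
by move=> mdiag A mA _; exact: aa_volume_swap.
Qed.

End Disintegration.

(** * Weights on the first diagonal *)

Section Weights.
Variable R : realType.
Local Notation lambda := (@lebesgue_measure R).
Local Notation mu := (lambda \x lambda)%E.
Implicit Types (x y r : R).

(* [acos] takes the junk value 0 outside [-1, 1]; this truncation is monotone on
   the whole line. *)
Definition cacos x : R := acos (Num.max (- 1) (Num.min x 1)).

Lemma cacosE x : -1 <= x <= 1 -> cacos x = acos x.
Proof. by rewrite /cacos => /andP[x1 x2]; rewrite min_l// max_r. Qed.

Lemma clamp_bound x : -1 <= Num.max (- 1) (Num.min x 1) <= 1.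
Proof. by rewrite le_max lexx/= ge_max ge_min lexx orbT andbT; lra. Qed.

Lemma ler_acos x y : -1 <= x -> x <= y -> y <= 1 -> acos y <= acos x.
Proof.
move=> x1 xy y1; have x11 : -1 <= x <= 1 by rewrite x1 (le_trans xy).
have y11 : -1 <= y <= 1 by rewrite y1 (le_trans x1).
by have := ler_asin x1 xy y1; rewrite !asin_acos//; lra.
Qed.

Lemma cacos_nincr : nonincreasing_fun cacos.
Proof.
move=> x y xy; have /andP[x1 _] := clamp_bound x; have /andP[_ y1] := clamp_bound y.
by apply: ler_acos => //; apply: le_max2 => //; apply: le_min2.
Qed.

Lemma measurable_cacos : measurable_fun [set: R] cacos.
Proof. by apply: nonincreasing_measurable => //; exact: cacos_nincr. Qed.

Lemma cacos_ge0 x : 0 <= cacos x.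
Proof. by apply: acos_ge0; exact: clamp_bound. Qed.

Lemma cacos_lepi x : cacos x <= pi.
Proof. by apply: acos_lepi; exact: clamp_bound. Qed.

(* The exterior angles at the two vertices off a diagonal of length [x] are both
   [2 * acos (x / 2)]. *)
Definition turning x : R := 4 * cacos (x / 2).

Lemma turning_ge0 x : 0 <= turning x.
Proof. by rewrite mulr_ge0// cacos_ge0. Qed.

Lemma turning_le x : turning x <= 4 * pi.
Proof. by rewrite ler_pM2l// cacos_lepi. Qed.

Lemma turning_nincr : nonincreasing_fun turning.
Proof. by move=> x y xy; rewrite ler_pM2l// cacos_nincr// ler_pM2r. Qed.

Lemma measurable_turning : measurable_fun [set: R] turning.
Proof. by apply: nonincreasing_measurable => //; exact: turning_nincr. Qed.

Definition diameter_le r : set (aa_coord R) :=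
  [set p | p.1 <= r /\ second_diagonal p <= r].

Lemma measurable_diameter_le r : measurable (diameter_le r).
Proof.
have -> : diameter_le r =
    (fst @^-1` `]-oo, r]) `&` (@second_diagonal R @^-1` `]-oo, r]).
  by apply/seteqP; split=> p /=; rewrite !in_itv.
apply: measurableI; rewrite -[X in measurable X]setTI.
  exact: measurable_fst.
by apply: measurable_second_diagonal => //; exact: measurable_itv.
Qed.

(** For 0 < x < 2 and r >= 0 this is 4 asin(r / sqrt(4 - x^2)) as long as the quotient is at most 1.
    The truncated arccosine makes it saturate at 2 pi, the full circle of angles, beyond that. *)
Definition slice r x : R := 2 * pi - 4 * cacos (r / Num.sqrt (4 - x ^+ 2)).

Lemma measurable_slice r : measurable_fun [set: R] (slice r).
Proof.
apply: measurable_funB => //; apply: measurable_funM => //.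
apply: (measurableT_comp measurable_cacos); apply: measurable_funM => //.
apply: (measurableT_comp (@measurable_sqrtrV R)).
by apply: measurable_funB => //; exact: measurable_funX.
Qed.

Lemma slice_ge0 r x : 0 <= r -> 0 <= slice r x.
Proof.
move=> r0; rewrite subr_ge0.
suff : cacos (r / Num.sqrt (4 - x ^+ 2)) <= pi / 2 by lra.
rewrite -acos0 -(cacosE (x := 0)); last by apply/andP; split; lra.
by apply: cacos_nincr; rewrite divr_ge0// sqrtr_ge0.
Qed.

Lemma slice_le r x : slice r x <= 2 * pi.
Proof. by rewrite lerBlDr lerDl mulr_ge0// cacos_ge0. Qed.

Lemma measure_slice r x : 0 <= r -> 0 < x < 2 ->
  lambda (`[0, 2 * pi[ `&` [set t | second_diagonal (x, t) <= r]) = (slice r x)%:E.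
Proof.
move=> r0 /andP[x0 x2]; rewrite /second_diagonal/= /slice.
have D : 0 < 4 - x ^+ 2.
  by rewrite subr_gt0 (_ : 4 = 2 ^+ 2) ?ltr_pXn2r ?nnegrE//; [lra|ring].
set c := Num.sqrt _; have c0 : 0 < c by rewrite sqrtr_gt0.
pose A := [set t | (r < c * sin (t / 2))%R].
have mA : measurable A.
  rewrite (_ : A = (fun t => c * sin (t / 2)) @^-1` `]r, +oo[); last first.
    by apply/seteqP; split=> t /=; rewrite in_itv/= andbT.
  rewrite -[X in measurable X]setTI.
  have : measurable_fun [set: R] (fun t => c * sin (t / 2)).
    apply: measurable_funM => //.
    apply: (measurableT_comp (continuous_measurable_fun (@continuous_sin R))).
    exact: measurable_funM.
  by apply => //; exact: measurable_itv.
have -> : [set t | c * sin (t / 2) <= r] = ~` A.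
  by apply/seteqP; split=> t /=; rewrite /A/= leNgt => /negP.
have p0 := @pi_gt0 R.
have I : lambda `[0, 2 * pi[%classic = (2 * pi)%:E.
  by rewrite lebesgue_measure_itv/= lte_fin ifT ?subr0 ?sube0//; lra.
have Ioo : (lambda `[0%R, (2 * pi)%R[%classic < +oo)%E by rewrite I ltry.
rewrite -setDE (@measureD _ _ _ lambda _ A)//.
transitivity (lambda `[0%R, (2 * pi)%R[ - lambda (`[0%R, (2 * pi)%R[ `&` A))%E => //.
rewrite I measure_sin_half_gt// max_l//.
case: ifPn => rc.
  rewrite cacosE// ler_pdivlMr// ler_pdivrMr//; apply/andP; split; lra.
have rc1 : 1 <= r / c by rewrite ler_pdivlMr// mul1r leNgt.
have -> : cacos (r / c) = 0 by rewrite /cacos min_r// max_r ?acos1//; lra.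
by rewrite mulr0 subr0 sube0.
Qed.

Definition weight r x : R := if x <= r then slice r x else 0.

Lemma measurable_weight r : measurable_fun [set: R] (weight r).
Proof.
apply: measurable_fun_ifT => //; last exact: measurable_slice.
by apply: measurable_fun_ler.
Qed.

Lemma weight_ge0 r x : 0 <= r -> 0 <= weight r x.
Proof. by move=> r0; rewrite /weight; case: ifP => // _; exact: slice_ge0. Qed.

Lemma weight_le r x : weight r x <= 2 * pi.
Proof.
rewrite /weight; case: ifP => _; first exact: slice_le.
by have := @pi_ge0 R; lra.
Qed.

Lemma integral_diameter_le_fst (h : R -> R) r : 0 <= r ->
  measurable_fun setT h -> (forall x, 0 <= h x) ->
  (\int[mu]_(p in @aa_domain R `&` diameter_le r) (h p.1)%:E =
   \int[lambda]_(x in `]0%R, 2%R[) (h x * weight r x)%:E)%E.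
Proof.
move=> r0 mh h0; rewrite integral_mkcondr ge0_integral_aa_domain; last 2 first.
- have [H _] := measurable_restrictT (fun p : aa_coord R => (h p.1)%:E)
    (measurable_diameter_le r).
  apply: H; apply/measurable_EFinP; apply: measurable_funTS.
  by apply: (measurableT_comp mh); exact: measurable_fst.
- by move=> p; rewrite patchE; case: ifP => _ //; rewrite lee_fin.
apply: eq_integral => x; rewrite inE/= in_itv/= => x02.
rewrite /weight; case: ifPn => xr; last first.
  rewrite mulr0 integral0_eq// => t _; rewrite patchE ifN// notin_setE /diameter_le/=.
  by case; rewrite (negbTE xr).
pose B := [set t | second_diagonal (x, t) <= r].
rewrite (eq_integral ((fun=> (h x)%:E) \_ B)); last first.
  move=> t _; rewrite !patchE; congr (if _ then _ else _).
  by apply/idP/idP; rewrite !inE /diameter_le/=; [case|].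
rewrite -integral_mkcondr integral_cst/=; last first.
  apply: measurableI => //.
  have := measurable_second_diagonal; move=> /(_ R) m2.
  have : measurable_fun [set: measurableTypeR R] (fun t => second_diagonal (x, t)).
    by apply: (measurableT_comp m2).
  move=> /(_ measurableT `]-oo, r]%classic); rewrite setTI.
  rewrite (_ : _ @^-1` _ = B); first by apply; exact: measurable_itv.
  by apply/seteqP; split=> t /=; rewrite in_itv.
by rewrite measure_slice// EFinM.
Qed.

(** The conditions l <= r and d <= r are exchanged by the swap, so their conjunction is invariant.
    Hence the curvature integral is twice its contribution from the first diagonal. *)
Lemma integral_diameter_le_snd (h : R -> R) r :
  measurable_fun setT h -> (forall x, 0 <= h x) ->
  (\int[mu]_(p in @aa_domain R `&` diameter_le r) (h (second_diagonal p))%:E =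
   \int[mu]_(p in @aa_domain R `&` diameter_le r) (h p.1)%:E)%E.
Proof.
move=> mh h0; rewrite integral_mkcondr [RHS]integral_mkcondr.
pose Q : set (aa_coord R) := (fst @^-1` `]-oo, r]) `&` (snd @^-1` `]-oo, r]).
have mQ : measurable Q.
  apply: measurableI; rewrite -[X in measurable X]setTI.
    exact: measurable_fst.
  exact: measurable_snd.
pose F : aa_coord R -> \bar R := (fun p => (h p.2)%:E) \_ Q.
have mF : measurable_fun setT F.
  have [H _] := measurable_restrictT (fun p : aa_coord R => (h p.2)%:E) mQ.
  apply: H; apply/measurable_EFinP; apply: measurable_funTS.
  by apply: (measurableT_comp mh); exact: measurable_snd.
have F0 p : (0 <= F p)%E by rewrite /F patchE; case: ifP => _ //; rewrite lee_fin.
have E1 : (fun p => (h (second_diagonal p))%:E) \_ (diameter_le r) =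
    (fun p => F (p.1, second_diagonal p)).
  by apply/funext => p; rewrite /F !patchE; congr (if _ then _ else _).
have E2 : (fun p => (h p.1)%:E) \_ (diameter_le r) =
    (fun p => F (second_diagonal p, p.1)).
  apply/funext => p; rewrite /F !patchE; congr (if _ then _ else _).
  by apply/idP/idP; rewrite !inE => -[].
by rewrite E1 E2 ge0_integral_swap.
Qed.
End Weights.

(** * Diameter at most sqrt 2 *)

Section FirstRange.
Variable R : realType.
Local Notation lambda := (@lebesgue_measure R).
Local Notation mu := (lambda \x lambda)%E.

Lemma integrableZ_EFin d (T : measurableType d) (m : {measure set T -> \bar R})
    (D : set T) (k : R) (f : T -> R) : measurable D ->
  m.-integrable D (EFin \o f) -> m.-integrable D (EFin \o (fun x => k * f x)).
Proof. by move=> mD fi; exact: (integrableZl mD k fi). Qed.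

Lemma integrableB_EFin d (T : measurableType d) (m : {measure set T -> \bar R})
    (D : set T) (f g : T -> R) : measurable D ->
  m.-integrable D (EFin \o f) -> m.-integrable D (EFin \o g) ->
  m.-integrable D (EFin \o (fun x => f x - g x)).
Proof. by move=> mD fi gi; exact: (integrableB mD fi gi). Qed.

Lemma Rintegral_lincomb d (T : measurableType d) (m : {measure set T -> \bar R})
    (D : set T) (u v w z : T -> R) (a b c e : R) : measurable D ->
  m.-integrable D (EFin \o u) -> m.-integrable D (EFin \o v) ->
  m.-integrable D (EFin \o w) -> m.-integrable D (EFin \o z) ->
  \int[m]_(x in D) (a * u x - b * v x - (c * w x - e * z x)) =
  a * \int[m]_(x in D) u x - b * \int[m]_(x in D) v x -
  (c * \int[m]_(x in D) w x - e * \int[m]_(x in D) z x).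
Proof.
move=> mD iu iv iw iz; rewrite !RintegralB// ?RintegralZl//;
  repeat (apply: integrableB_EFin => // || apply: integrableZ_EFin => //).
Qed.

(* Chebyshev's inequality, by integrating the last hypothesis over [D * D]. *)
Lemma Rintegral_chebyshev d (T : measurableType d) (m : {measure set T -> \bar R})
    (D : set T) (g p q : T -> R) : measurable D ->
  m.-integrable D (EFin \o p) -> m.-integrable D (EFin \o q) ->
  m.-integrable D (EFin \o (fun x => g x * p x)) ->
  m.-integrable D (EFin \o (fun x => g x * q x)) ->
  (forall x y, D x -> D y -> 0 <= (g x - g y) * (p x * q y - p y * q x)) ->
  (\int[m]_(x in D) (g x * q x)) * (\int[m]_(x in D) p x) <=
  (\int[m]_(x in D) (g x * p x)) * (\int[m]_(x in D) q x).
Proof.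
move=> mD ip iq igp igq pq0.
set GQ := Rintegral _ _ (fun x => g x * q x).
set GP := Rintegral _ _ (fun x => g x * p x).
set P := Rintegral _ _ p; set Q := Rintegral _ _ q.
have inner y : D y -> 0 <= GP * q y - GQ * p y - (P * (g y * q y) - Q * (g y * p y)).
  move=> Dy.
  have : 0 <= \int[m]_(x in D) (q y * (g x * p x) - p y * (g x * q x) -
      (g y * q y * p x - g y * p y * q x)).
    apply: Rintegral_ge0 => x Dx.
    have -> : q y * (g x * p x) - p y * (g x * q x) -
      (g y * q y * p x - g y * p y * q x) = (g x - g y) * (p x * q y - p y * q x) by ring.
    exact: pq0.
  rewrite Rintegral_lincomb// -/GP -/GQ -/P -/Q; lra.
have := Rintegral_ge0 m inner.
rewrite Rintegral_lincomb// -/GP -/GQ -/P -/Q; lra.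
Qed.

Lemma bounded_integrable (f : R -> R) (a b M : R) : measurable_fun setT f ->
  (forall x, 0 <= f x <= M) -> lambda.-integrable `]a, b[ (EFin \o f).
Proof.
move=> mf f0M; apply: measurable_bounded_integrable => //.
- rewrite /= lebesgue_measure_itv/=; by case: ifP => _; rewrite ltry.
- exact: measurable_funTS.
- exists M; split; first exact: num_real.
  by move=> y My x _; have /andP[f0 fM] := f0M x; rewrite /= ger0_norm// (le_trans fM)// ltW.
Qed.

Definition volume_le (r : R) : R := fine (mu (@aa_domain R `&` diameter_le r)).

Definition curvature_le (r : R) : R := \int[mu]_(p in @aa_domain R `&` diameter_le r)
  (turning p.1 + turning (second_diagonal p)).

Lemma integrable_weight r : 0 <= r -> lambda.-integrable `]0, 2[ (EFin \o weight r).
Proof.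
move=> r0; apply: (@bounded_integrable _ _ _ (2 * pi)); first exact: measurable_weight.
by move=> x; rewrite weight_ge0// weight_le.
Qed.

Lemma integrable_turning_weight r : 0 <= r ->
  lambda.-integrable `]0, 2[ (EFin \o (fun x => turning x * weight r x)).
Proof.
move=> r0; apply: (@bounded_integrable _ _ _ (4 * pi * (2 * pi))).
  by apply: measurable_funM; [exact: measurable_turning|exact: measurable_weight].
move=> x; rewrite mulr_ge0 ?turning_ge0 ?weight_ge0//=.
by rewrite ler_pM ?turning_ge0 ?weight_ge0 ?turning_le ?weight_le.
Qed.

Lemma volume_leE r : 0 <= r -> volume_le r = \int[lambda]_(x in `]0, 2[) weight r x.
Proof.
move=> r0; rewrite /volume_le /Rintegral; congr fine.
have := @integral_diameter_le_fst R (fun=> 1) r r0 (measurable_cst _) (fun=> ler01).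
rewrite integral_cst/= ?mul1e => [->|].
  by apply: eq_integral => x _; rewrite mul1r.
by apply: measurableI; [exact: measurable_aa_domain|exact: measurable_diameter_le].
Qed.

Lemma curvature_leE r : 0 <= r ->
  curvature_le r = 2 * \int[lambda]_(x in `]0, 2[) (turning x * weight r x).
Proof.
move=> r0; have mS : measurable (@aa_domain R `&` diameter_le r).
  by apply: measurableI; [exact: measurable_aa_domain|exact: measurable_diameter_le].
rewrite /curvature_le /Rintegral.
under eq_integral do rewrite EFinD.
have mt1 : measurable_fun (@aa_domain R `&` diameter_le r) (fun p => (turning p.1)%:E).
  apply/measurable_EFinP; apply: measurable_funTS.
  by apply: (measurableT_comp (@measurable_turning R)); exact: measurable_fst.
have mt2 : measurable_fun (@aa_domain R `&` diameter_le r)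
    (fun p => (turning (second_diagonal p))%:E).
  apply/measurable_EFinP; apply: measurable_funTS.
  apply: (measurableT_comp (@measurable_turning R)).
  exact: measurable_second_diagonal.
rewrite ge0_integralD//; last 2 first.
- by move=> p _; rewrite lee_fin turning_ge0.
- by move=> p _; rewrite lee_fin turning_ge0.
rewrite integral_diameter_le_snd; [|exact: measurable_turning|exact: turning_ge0].
rewrite integral_diameter_le_fst//; [|exact: measurable_turning|exact: turning_ge0].
have fi : (\int[lambda]_(x in `]0%R, 2%R[) (turning x * weight r x)%:E)%E \is a fin_num.
  by apply: integrable_fin_num => //; exact: integrable_turning_weight.
by rewrite fineD ?fi// mulr2n mulrDl !mul1r.
Qed.

(** Put c_z = sqrt(4 - z^2) and k = c_y / c_x. Then r / c_x = k (r / c_y), and likewise for s, so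
    the claim is [asin_ratio] at r / c_y <= s / c_y. The bound s <= sqrt 2 gives s <= c_z for z
    between x and y, so that no slice is truncated. The case x = y is separate because [asin_ratio]
    asks for k < 1. *)
Lemma slice_ratio (r s x y : R) : 0 <= r -> r <= s -> s <= Num.sqrt 2 ->
  0 < x -> x <= y -> y <= r -> slice r y * slice s x <= slice r x * slice s y.
Proof.
move=> r0 rs s2 x0 xy yr.
have s22 : s ^+ 2 <= 2.
  by rewrite -[leRHS]sqr_sqrtr// ler_pXn2r// ?nnegrE ?sqrtr_ge0//; lra.
have yr2 : y ^+ 2 <= s ^+ 2 by rewrite ler_pXn2r ?nnegrE//; lra.
have c0 z : x <= z -> z <= y -> 0 < Num.sqrt (4 - z ^+ 2) /\ s <= Num.sqrt (4 - z ^+ 2).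
  move=> xz zy; have zy2 : z ^+ 2 <= y ^+ 2 by rewrite ler_pXn2r ?nnegrE//; lra.
  rewrite sqrtr_gt0; split; first by lra.
  rewrite -[leLHS]ger0_norm -?sqrtr_sqr ?ler_wsqrtr//; lra.
have [cx0 scx] := c0 x (lexx x) xy; have [cy0 scy] := c0 y xy (lexx y).
have sliceE t z : 0 <= t -> t <= s -> 0 < Num.sqrt (4 - z ^+ 2) ->
    s <= Num.sqrt (4 - z ^+ 2) -> slice t z = 4 * asin (t / Num.sqrt (4 - z ^+ 2)).
  move=> t0 ts z0 sz; rewrite /slice; set c := Num.sqrt _ in z0 sz *.
  have tc : -1 <= t / c <= 1.
    by rewrite ler_pdivlMr// ler_pdivrMr// mulN1r mul1r; apply/andP; split; lra.
  by rewrite cacosE// asin_acos//; field.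
rewrite !sliceE//; try lra.
move: xy; rewrite le_eqVlt => /predU1P[<-|xy]; first exact: lexx.
have : Num.sqrt (4 - y ^+ 2) < Num.sqrt (4 - x ^+ 2).
  rewrite ltr_sqrt; last by move: cx0; rewrite sqrtr_gt0.
  by rewrite ltrD2l ltrN2 ltr_pXn2r ?nnegrE//; lra.
set cy := Num.sqrt (4 - y ^+ 2) in cy0 scy *; set cx := Num.sqrt _ in cx0 scx *.
move=> cyx; pose k := cy / cx.
have kE t : t / cx = k * (t / cy) by rewrite /k; field; rewrite !gt_eqF.
have := @asin_ratio R k (r / cy) (s / cy).
rewrite -!kE => H.
have {}H : asin (r / cy) * asin (s / cx) <= asin (s / cy) * asin (r / cx).
  apply: H.
  - by rewrite /k divr_ge0 ?(ltW cy0) ?(ltW cx0)//= ltr_pdivrMr// mul1r.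
  - by rewrite divr_ge0 ?(ltW cy0).
  - by rewrite ler_pM2r// invr_gt0.
  - by rewrite ler_pdivrMr// mul1r.
lra.
Qed.

Lemma curvature_le_first_range (r s : R) : 0 <= r -> r <= s -> s <= Num.sqrt 2 ->
  curvature_le s * volume_le r <= curvature_le r * volume_le s.
Proof.
move=> r0 rs s2; have s0 : 0 <= s by exact: le_trans rs.
rewrite !curvature_leE// !volume_leE// -!mulrA ler_pM2l//.
apply: Rintegral_chebyshev => //.
- exact: integrable_weight.
- exact: integrable_weight.
- exact: integrable_turning_weight.
- exact: integrable_turning_weight.
have H x y : 0 < x -> x <= y ->
    0 <= (turning x - turning y) * (weight r x * weight s y - weight r y * weight s x).
  move=> x0 xy; apply: mulr_ge0; first by rewrite subr_ge0 turning_nincr.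
  (* If y > r the subtracted product vanishes with [weight r y]; otherwise all four weights are
     slices. *)
  rewrite subr_ge0; have [yr|yr] := leP y r; last first.
    by rewrite [weight r y]/weight (lt_geF yr) mul0r mulr_ge0// weight_ge0.
  rewrite /weight yr (le_trans xy yr) (le_trans yr rs) (le_trans xy (le_trans yr rs)).
  exact: slice_ratio.
move=> x y /=; rewrite !in_itv/= => /andP[x0 _] /andP[y0 _].
have [xy|/ltW yx] := leP x y; first exact: H.
have -> : (turning x - turning y) * (weight r x * weight s y - weight r y * weight s x) =
  (turning y - turning x) * (weight r y * weight s x - weight r x * weight s y) by ring.
exact: H.
Qed.
End FirstRange.

(** * Diameter at least sqrt 2 *)

Section SecondRange.
Variable R : realType.
Local Notation lambda := (@lebesgue_measure R).
Local Notation mu := (lambda \x lambda)%E.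

Definition strip (r s : R) : set (aa_coord R) := [set p | r < p.1 <= s].

Lemma measurable_strip r s : measurable (strip r s).
Proof.
have -> : strip r s = fst @^-1` `]r, s] by apply/seteqP; split=> p; rewrite /strip/= in_itv.
by rewrite -[X in measurable X]setTI; exact: measurable_fst.
Qed.

(** An integrand in the angle alone arises by freezing l at an end of the strip. This gives the
    volume of a strip and two-sided bounds on its curvature. *)
Lemma integral_strip_snd (K : R -> R) (q r s : R) : 0 <= r -> r <= s -> s <= 2 ->
  measurable_fun setT K -> (forall t, 0 <= K t) ->
  (\int[lambda]_(t in `[0%R, (2 * pi)%R[) (K t)%:E = q%:E)%E ->
  (\int[mu]_(p in @aa_domain R `&` strip r s) (K p.2)%:E = (q * (s - r))%:E)%E.
Proof.
move=> r0 rs s2 mK K0 Kq.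
rewrite integral_mkcondr ge0_integral_aa_domain; last 2 first.
- have [H _] := measurable_restrictT (fun p : aa_coord R => (K p.2)%:E)
    (measurable_strip r s).
  apply: H; apply/measurable_EFinP; apply: measurable_funTS.
  by apply: (measurableT_comp mK); exact: measurable_snd.
- by move=> p; rewrite patchE; case: ifP => _ //; rewrite lee_fin.
transitivity (\int[lambda]_(x in `]0%R, 2%R[ `&` `]r, s]) (cst q%:E x))%E.
  rewrite [RHS]integral_mkcondr; apply: eq_integral => x _; rewrite [RHS]patchE.
  case: ifPn; rewrite ?notin_setE ?inE => xrs.
    rewrite -Kq; apply: eq_integral => t _; rewrite patchE ifT//.
    by rewrite inE /strip/=; move: xrs; rewrite /= in_itv.
  rewrite integral0_eq// => t _; rewrite patchE ifN// notin_setE /strip/=.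
  by move=> h; apply: xrs; rewrite /= in_itv.
rewrite integral_cst/=; last by apply: measurableI; exact: measurable_itv.
rewrite EFinM; congr (_ * _)%E.
(* The domain is open at l = 2, so for s = 2 the strip loses its last point, a null set. *)
have [s2'|s2'] := ltP s 2.
  rewrite setIidr; last first.
    move=> x /=; rewrite !in_itv/= => /andP[rx xs].
    by rewrite (le_lt_trans r0 rx) (le_lt_trans xs s2').
  rewrite lebesgue_measure_itv/= lte_fin; case: ltP => // sr.
  have -> : s = r by apply/eqP; rewrite eq_le sr.
  by rewrite subrr.
have -> : s = 2 by apply/eqP; rewrite eq_le s2.
have -> : `]0, 2[%classic `&` `]r, 2] = `]r, 2[%classic :> set R.
  apply/seteqP; split=> x /=; rewrite !in_itv/=; first by move=> [/andP[_ ->] /andP[->]].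
  by move=> /andP[rx x2]; rewrite rx x2 (le_lt_trans r0 rx) ltW.
rewrite lebesgue_measure_itv/= lte_fin; case: ltP => // sr.
have -> : r = 2 by apply/eqP; rewrite eq_le sr (le_trans rs s2).
by rewrite subrr.
Qed.

Lemma aa_domain_second_diagonal (p : aa_coord R) : aa_domain p ->
  [/\ 0 < p.1, p.1 < 2, 0 <= second_diagonal p &
      p.1 ^+ 2 + second_diagonal p ^+ 2 <= 4].
Proof.
rewrite /aa_domain /second_diagonal/= !in_itv/= => -[/andP[x0 x2] /andP[t0 t2]].
have D : 0 < 4 - p.1 ^+ 2.
  by rewrite subr_gt0 (_ : 4 = 2 ^+ 2) ?ltr_pXn2r ?nnegrE//; [lra|ring].
have s0 : 0 <= sin (p.2 / 2) by apply: sin_ge0_pi; lra.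
split=> //; first by rewrite mulr_ge0// sqrtr_ge0.
rewrite exprMn sqr_sqrtr; last exact: ltW.
have s1 : sin (p.2 / 2) ^+ 2 <= 1.
  by have := cos2Dsin2 (p.2 / 2); have := sqr_ge0 (cos (p.2 / 2)); lra.
have := sqr_ge0 (sin (p.2 / 2)); nra.
Qed.

Lemma integral_diameter_le_increment (F : aa_coord R -> R) (r s : R) :
  measurable_fun setT F -> (forall p, 0 <= F p) -> (forall x y, F (x, y) = F (y, x)) ->
  Num.sqrt 2 <= r -> r <= s ->
  (\int[mu]_(p in @aa_domain R `&` diameter_le s) (F (diagonals p))%:E =
   \int[mu]_(p in @aa_domain R `&` diameter_le r) (F (diagonals p))%:E +
   (\int[mu]_(p in @aa_domain R `&` strip r s) (F (diagonals p))%:E +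
    \int[mu]_(p in @aa_domain R `&` strip r s) (F (diagonals p))%:E))%E.
Proof.
move=> mF F0 FC r2 rs.
have r0 : 0 <= r by apply: le_trans r2; rewrite sqrtr_ge0.
have rr2 : 2 <= r ^+ 2.
  by rewrite -[leLHS]sqr_sqrtr// ler_pXn2r// nnegrE ?sqrtr_ge0.
pose strip' : set (aa_coord R) := [set p | r < second_diagonal p <= s].
have mstrip' : measurable strip'.
  have -> : strip' = @second_diagonal R @^-1` `]r, s].
    by apply/seteqP; split=> p; rewrite /strip'/= in_itv.
  rewrite -[X in measurable X]setTI.
  by apply: measurable_second_diagonal => //; exact: measurable_itv.
have mD := @measurable_aa_domain R.
have mA := measurableI _ _ mD (measurable_diameter_le r).
have mB := measurableI _ _ mD (measurable_strip r s).
have mC := measurableI _ _ mD mstrip'.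
(* Two diagonals both longer than r >= sqrt 2 would have squares summing to more than 4. *)
have big x y : 0 <= y -> r < x -> x ^+ 2 + y ^+ 2 <= 4 -> y <= r.
  move=> y0 rx xy; rewrite leNgt; apply/negP => ry.
  have : r ^+ 2 < x ^+ 2 by rewrite ltr_pXn2r ?nnegrE//; lra.
  have : r ^+ 2 < y ^+ 2 by rewrite ltr_pXn2r ?nnegrE//; lra.
  lra.
have -> : @aa_domain R `&` diameter_le s = (@aa_domain R `&` diameter_le r) `|`
    ((@aa_domain R `&` strip r s) `|` (@aa_domain R `&` strip')).
  apply/seteqP; split=> p.
    move=> [Dp [xs ds]]; have [xr|xr] := leP p.1 r; last first.
      by right; left; split=> //; rewrite /strip/= xr.
    have [dr|dr] := leP (second_diagonal p) r; first by left.
    by right; right; split=> //; rewrite /strip'/= dr.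
  have E (q : aa_coord R) : aa_domain q -> _ := @aa_domain_second_diagonal q.
  move=> [[Dp [xr dr]]|[[Dp /andP[rx xs]]|[Dp /andP[rd ds]]]]; have [x0 x2 d0 xd] := E p Dp.
  - by split=> //; split; apply: le_trans rs.
  - split=> //; split=> //; apply: le_trans rs.
    exact: (big p.1).
  - split=> //; split=> //; apply: le_trans rs.
    by apply: (big (second_diagonal p)); rewrite ?(ltW x0)// addrC.
have mFd (A : set (aa_coord R)) : measurable_fun A (fun p => (F (diagonals p))%:E).
  apply/measurable_EFinP; apply: measurable_funTS.
  by apply: (measurableT_comp mF); exact: measurable_diagonals.
have F0' p : (0 <= (F (diagonals p))%:E)%E by rewrite lee_fin.
rewrite ge0_integral_setU//; [|exact: measurableU|]; last first.
  apply/disj_setPS => p [[Dp [xr dr]]] [[_ /andP[]]|[_ /andP[]]];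
    by rewrite ltNge ?xr ?dr.
rewrite ge0_integral_setU//; last first.
  apply/disj_setPS => p [[Dp /andP[rx _]] [_ /andP[rd _]]].
  have [x0 x2 d0 xd] := aa_domain_second_diagonal Dp.
  by have := big _ _ d0 rx xd; rewrite leNgt rd.
(* Since [F] is symmetric, the swap carries the strip in d to the strip in l without changing the
   integrand. *)
congr (_ + (_ + _))%E; rewrite integral_mkcondr [RHS]integral_mkcondr.
pose Q : set (aa_coord R) := fst @^-1` `]r, s].
have mQ : measurable Q.
  by rewrite -[X in measurable X]setTI; exact: measurable_fst.
pose G : aa_coord R -> \bar R := (EFin \o F) \_ Q.
have mG : measurable_fun setT G.
  have [H _] := measurable_restrictT (EFin \o F) mQ.
  by apply: H; apply/measurable_EFinP; apply: measurable_funTS.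
have G0 p : (0 <= G p)%E by rewrite /G patchE; case: ifP => _ //; rewrite lee_fin.
have -> : (fun p => (F (diagonals p))%:E) \_ (strip r s) =
    (fun p => G (p.1, second_diagonal p)).
  by apply/funext => p; rewrite /G !patchE; congr (if _ then _ else _).
have -> : (fun p => (F (diagonals p))%:E) \_ strip' =
    (fun p => G (second_diagonal p, p.1)).
  by apply/funext => p; rewrite /G !patchE /= FC; congr (if _ then _ else _).
by rewrite (ge0_integral_swap mG G0).
Qed.

(** Curvature per unit of l at l = x: 2 pi times the mean curvature of the polygons with first
    diagonal x. This accounts for the factors 2 pi in the comparisons below. *)
Definition strip_density x : R :=
  \int[lambda]_(t in `[0, 2 * pi[) (turning x + turning (second_diagonal (x, t))).

Lemma measurable_strip_integrand x : measurable_fun [set: R]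
  (fun t => turning x + turning (second_diagonal (x, t))).
Proof.
apply: measurable_funD => //; apply: (measurableT_comp (@measurable_turning R)).
rewrite /second_diagonal/=; apply: measurable_funM => //.
apply: (measurableT_comp (continuous_measurable_fun (@continuous_sin R))).
exact: measurable_funM.
Qed.

Lemma integrable_strip_integrand x : lambda.-integrable `[0, 2 * pi[
  (EFin \o (fun t => turning x + turning (second_diagonal (x, t)))).
Proof.
apply: measurable_bounded_integrable => //.
- by rewrite /= lebesgue_measure_itv/=; case: ifP => _; rewrite ltry.
- by apply: measurable_funTS; exact: measurable_strip_integrand.
- exists (4 * pi + 4 * pi); split; first exact: num_real.
  move=> y My t _; rewrite /= ger0_norm; last by rewrite addr_ge0// turning_ge0.
  by rewrite (le_trans _ (ltW My))// lerD// turning_le.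
Qed.

(** With a = acos(l / 2) and k = sin(t / 2), the curvature is 4 (a + pi / 2 - asin(k sin a)). By
    [asin_sin_lip] it is nondecreasing in a, and a decreases as l grows. *)
Lemma turning_strip_nincr (x y t : R) : 0 <= x -> x <= y -> y <= 2 -> 0 <= t <= 2 * pi ->
  turning y + turning (second_diagonal (y, t)) <=
  turning x + turning (second_diagonal (x, t)).
Proof.
move=> x0 xy y2 t02.
have s01 : 0 <= sin (t / 2) <= 1.
  by rewrite sin_le1 andbT; apply: sin_ge0_pi; lra.
have E z : 0 <= z -> z <= 2 -> turning z + turning (second_diagonal (z, t)) =
    4 * (acos (z / 2) + pi / 2 - asin (sin (t / 2) * sin (acos (z / 2)))).
  move=> z0 z2; have z11 : -1 <= z / 2 <= 1 by apply/andP; split; lra.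
  rewrite /turning /second_diagonal/= cacosE// sin_acos//.
  have -> : Num.sqrt (4 - z ^+ 2) * sin (t / 2) / 2 =
      sin (t / 2) * Num.sqrt (1 - (z / 2) ^+ 2).
    have -> : 4 - z ^+ 2 = 2 ^+ 2 * (1 - (z / 2) ^+ 2) by field.
    by rewrite sqrtrM ?sqr_ge0// sqrtr_sqr ger0_norm//; field.
  set w := sin _ * _.
  have w11 : -1 <= w <= 1.
    have /andP[s0 s1] := s01.
    have q0 : 0 <= Num.sqrt (1 - (z / 2) ^+ 2) by rewrite sqrtr_ge0.
    have q1 : Num.sqrt (1 - (z / 2) ^+ 2) <= 1.
      by rewrite -[leRHS]sqrtr1 ler_wsqrtr// gerBl sqr_ge0.
    by rewrite /w; apply/andP; split; nra.
  by rewrite cacosE// asin_acos//; field.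
have y0 : 0 <= y by exact: le_trans xy.
have x2 : x <= 2 by exact: le_trans y2.
rewrite !E//.
have a0 : 0 <= acos (y / 2) by apply: acos_ge0; apply/andP; split; lra.
have axy : acos (y / 2) <= acos (x / 2) by apply: ler_acos; lra.
have ap : acos (x / 2) <= pi / 2.
  by rewrite -acos0; apply: ler_acos; lra.
have := asin_sin_lip s01 a0 axy ap; lra.
Qed.

Lemma strip_density_nincr (x y : R) : 0 <= x -> x <= y -> y <= 2 ->
  strip_density y <= strip_density x.
Proof.
move=> x0 xy y2; apply: le_Rintegral => //; [exact: integrable_strip_integrand..|].
move=> t /=; rewrite in_itv/= => /andP[t0 t2].
by apply: turning_strip_nincr => //; rewrite t0 ltW.
Qed.
End SecondRange.

(** * Growth of volume and curvature with the diameter bound *)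

Section BaseCase.
Variable R : realType.
Local Notation lambda := (@lebesgue_measure R).
Local Notation mu := (lambda \x lambda)%E.

Lemma aa_domain_lty (A : set (aa_coord R)) : measurable A ->
  (mu (@aa_domain R `&` A) < +oo)%E.
Proof.
move=> mA; apply: le_lt_trans (aa_volume_fin R); rewrite /mrestr setTI.
apply: (@le_measure _ _ _ mu); rewrite ?inE//.
- by apply: measurableI => //; exact: measurable_aa_domain.
- exact: measurable_aa_domain.
Qed.

Lemma volume_le_fin (r : R) :
  mu (@aa_domain R `&` diameter_le r) = (volume_le r)%:E.
Proof.
rewrite /volume_le fineK// ge0_fin_numE; last exact: measure_ge0.
by apply: aa_domain_lty; exact: measurable_diameter_le.
Qed.

Lemma measurable_turning_sum (A : set (aa_coord R)) :
  measurable_fun A (fun p => (turning p.1 + turning (second_diagonal p))%:E).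
Proof.
apply/measurable_EFinP; apply: measurable_funTS; apply: measurable_funD.
  by apply: (measurableT_comp (@measurable_turning R)); exact: measurable_fst.
apply: (measurableT_comp (@measurable_turning R)).
exact: measurable_second_diagonal.
Qed.

Lemma curvature_le_fin (r : R) :
  (\int[mu]_(p in @aa_domain R `&` diameter_le r)
     (turning p.1 + turning (second_diagonal p))%:E = (curvature_le r)%:E)%E.
Proof.
rewrite /curvature_le /Rintegral fineK// ge0_fin_numE; last first.
  by apply: integral_ge0 => p _; rewrite lee_fin addr_ge0// turning_ge0.
have mS : measurable (@aa_domain R `&` diameter_le r).
  by apply: measurableI; [exact: measurable_aa_domain|exact: measurable_diameter_le].
apply: (@le_lt_trans _ _
    (\int[mu]_(p in @aa_domain R `&` diameter_le r) (cst (4 * pi + 4 * pi)%:E p))%E).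
  apply: ge0_le_integral => //.
  - by move=> p _; rewrite lee_fin addr_ge0// turning_ge0.
  - exact: measurable_turning_sum.
  - by move=> p _; rewrite lee_fin lerD// turning_le.
by rewrite integral_cst//= volume_le_fin -EFinM ltry.
Qed.

Lemma volume_le_increment (r s : R) : Num.sqrt 2 <= r -> r <= s -> s <= 2 ->
  volume_le s = volume_le r + 4 * pi * (s - r).
Proof.
move=> r2 rs s2; have r0 : 0 <= r by apply: le_trans r2; rewrite sqrtr_ge0.
have mS t : measurable (@aa_domain R `&` diameter_le t).
  by apply: measurableI; [exact: measurable_aa_domain|exact: measurable_diameter_le].
have := @integral_diameter_le_increment R (fun=> 1) r s (measurable_cst _)
  (fun=> ler01) (fun _ _ => erefl) r2 rs.
have -> := @integral_strip_snd R (fun=> 1) (2 * pi) r s r0 rs s2 (measurable_cst _)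
  (fun=> ler01); last first.
  rewrite integral_cst//= mul1e lebesgue_measure_itv/= lte_fin ifT ?sube0//.
  by rewrite mulr_gt0// pi_gt0.
rewrite !integral_cst//= !mul1e !volume_le_fin -!EFinD => -[->].
by congr (_ + _); ring.
Qed.

(** Within the strip and at a fixed angle, the curvature lies between its values at l = s and at l =
    r. The factor 2 counts the two strips. *)
Lemma curvature_le_increment (r s : R) : Num.sqrt 2 <= r -> r <= s -> s <= 2 ->
  curvature_le r + 2 * strip_density s * (s - r) <= curvature_le s <=
  curvature_le r + 2 * strip_density r * (s - r).
Proof.
move=> r2 rs s2; have r0 : 0 <= r by apply: le_trans r2; rewrite sqrtr_ge0.
have mS : measurable (@aa_domain R `&` strip r s).
  by apply: measurableI; [exact: measurable_aa_domain|exact: measurable_strip].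
have mF : measurable_fun setT (fun p : aa_coord R => turning p.1 + turning p.2).
  apply: measurable_funD; apply: (measurableT_comp (@measurable_turning R)).
    exact: measurable_fst.
  exact: measurable_snd.
have := @integral_diameter_le_increment R (fun p => turning p.1 + turning p.2) r s mF
  (fun p => addr_ge0 (turning_ge0 _) (turning_ge0 _)) (fun x y => addrC _ _) r2 rs.
rewrite !curvature_le_fin; set T := integral _ _ _.
pose K (x t : R) := turning x + turning (second_diagonal (x, t)).
have K0 (x t : R) : 0 <= K x t by rewrite addr_ge0// turning_ge0.
have mK (x : R) (A : set (aa_coord R)) : measurable_fun A (fun p => (K x p.2)%:E).
  apply/measurable_EFinP; apply: measurable_funTS.
  by apply: (measurableT_comp (@measurable_strip_integrand R x)); exact: measurable_snd.
have KE (x : R) : (\int[mu]_(p in @aa_domain R `&` strip r s) (K x p.2)%:E =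
    (strip_density x * (s - r))%:E)%E.
  apply: integral_strip_snd => //; first exact: measurable_strip_integrand.
  rewrite /strip_density /Rintegral fineK//; apply: integrable_fin_num => //.
  exact: integrable_strip_integrand.
have Tlo : ((strip_density s * (s - r))%:E <= T)%E.
  rewrite -KE; apply: ge0_le_integral => //.
  - by move=> p _; rewrite lee_fin.
  - exact: measurable_turning_sum.
  - move=> [x t] [[/= _ +] /andP[/= rx xs]]; rewrite in_itv/= lee_fin => /andP[t0 t2].
    by apply: turning_strip_nincr => //; [exact/ltW/(le_lt_trans r0)|rewrite t0 ltW].
have Thi : (T <= (strip_density r * (s - r))%:E)%E.
  rewrite -KE; apply: ge0_le_integral => //.
  - by move=> p _; rewrite lee_fin addr_ge0// turning_ge0.
  - exact: measurable_turning_sum.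
  - move=> [x t] [[/= _ +] /andP[/= rx xs]]; rewrite in_itv/= lee_fin => /andP[t0 t2].
    by apply: turning_strip_nincr => //; [exact: ltW|exact: le_trans xs s2|rewrite t0 ltW].
have Tfin : T \is a fin_num.
  by rewrite fin_real// (lt_le_trans _ Tlo) ?ltNyr//= (le_lt_trans Thi) ?ltry.
move: Tlo Thi; rewrite -(fineK Tfin) !lee_fin -!EFinD => Tlo Thi [->]; lra.
Qed.
End BaseCase.

(** * The comparison at sqrt 2 and its propagation *)

Section Sqrt2.
Variable R : realType.
Local Notation lambda := (@lebesgue_measure R).
Local Notation mu := (lambda \x lambda)%E.
Local Notation s2 := (Num.sqrt 2 : R).

Lemma sqr_sqrt2 : s2 ^+ 2 = 2. Proof. by rewrite sqr_sqrtr. Qed.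

Lemma sqrt2_gt0 : 0 < s2. Proof. by rewrite sqrtr_gt0. Qed.

Lemma acos_sqrt2V : acos (s2 / 2) = pi / 4.
Proof.
have p0 := @pi_gt0 R; have q0 := sqrt2_gt0; have q2 := sqr_sqrt2.
have c0 : 0 < cos (pi / 4 : R) by apply: cos_gt0_pihalf; lra.
have c2 : cos (pi / 4 : R) ^+ 2 = 2^-1.
  have := cos_mulr2n (pi / 4 : R).
  have -> : pi / 4 *+ 2 = pi / 2 :> R by rewrite mulr2n; field.
  by rewrite cos_pihalf mulr2n => h; lra.
have -> : s2 / 2 = cos (pi / 4).
  have h0 : 0 <= s2 / 2 by rewrite divr_ge0// ltW.
  apply/eqP; rewrite -(@eqrXn2 _ 2) ?(ltW c0)//.
  by rewrite c2 expr_div_n q2; apply/eqP; field.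
by rewrite cosK// in_itv/=; lra.
Qed.

Lemma continuous_Rintegral (f F : R -> R) (a b : R) : a <= b ->
  continuous f -> (forall x : R, is_derive x 1 F (f x)) ->
  lambda.-integrable `[a, b] (EFin \o f) /\ \int[lambda]_(x in `[a, b]) f x = F b - F a.
Proof.
move=> ab cf dF; split.
  apply: continuous_compact_integrable; first exact: segment_compact.
  exact: continuous_subspaceT.
by rewrite /Rintegral (integral_is_derive ab (fun x _ => cf x) (fun x _ => dF x)).
Qed.

(** At l = sqrt 2 the first diagonal contributes exactly pi. For the second, asin w >= w gives at
    most 2 pi - 2 sqrt 2 sin(t / 2); the sum integrates in closed form. *)
Lemma strip_density_sqrt2_le : strip_density s2 <= 6 * pi ^+ 2 - 8 * s2.
Proof.
have p0 := @pi_gt0 R; have q0 := sqrt2_gt0; have q2 := sqr_sqrt2.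
pose f (t : R) := 3 * pi - 2 * s2 * sin (t / 2).
pose F (t : R) := 3 * pi * t + 4 * s2 * cos (t / 2).
have cf : continuous f.
  move=> t; apply: cvgB; first exact: cvg_cst.
  apply: cvgM; first exact: cvg_cst.
  apply: continuous_comp; last exact: continuous_sin.
  by apply: cvgM; [exact: cvg_id|exact: cvg_cst].
have dF (t : R) : is_derive t 1 F (f t).
  have dh : is_derive t 1 (fun t : R => t / 2) 2^-1.
    by apply: is_derive_eq; rewrite ?scaler0 ?add0r ?scaler1 ?mulr1.
  have dc := @is_derive1_comp R (@cos R) (fun t => t / 2) t _ _ (is_derive_cos _) dh.
  have d1 : is_derive t 1 (fun t : R => 3 * pi * t) (3 * pi).
    by apply: is_derive_eq; rewrite ?scaler0 ?add0r ?addr0 ?scaler1 ?mulr1.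
  have d2 := @is_deriveZ R _ _ _ (4 * s2) _ _ _ dc.
  have -> : f t = 3 * pi + 4 * s2 *: (- sin (t / 2) * 2^-1).
    by rewrite /f /GRing.scale/=; field.
  exact: is_deriveD d1 d2.
have p20 : 0 <= 2 * pi :> R by lra.
have [if_ fE] := continuous_Rintegral p20 cf dF.
have FE : F (2 * pi) - F 0 = 6 * pi ^+ 2 - 8 * s2.
  rewrite /F mulr0 mul0r cos0 [2 * pi / 2]mulrAC divff// mul1r cospi; ring.
have ifo : lambda.-integrable `[0, 2 * pi[ (EFin \o f).
  apply: integrableS if_ => //.
  by apply: subset_itvl; rewrite bnd_simp.
rewrite -FE -fE -Rintegral_itv_bndo_bndc//.
apply: le_Rintegral => //.
- exact: integrable_strip_integrand.
- move=> t /=; rewrite in_itv/= => /andP[t0 t2].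
  have s01 : 0 <= sin (t / 2) <= 1.
    by rewrite sin_le1 andbT; apply: sin_ge0_pi; lra.
  have /andP[s0 s1] := s01.
  have q4 : s2 / 2 <= 1 by nra.
  rewrite /turning /second_diagonal/= q2.
  have -> : 4 - 2 = 2 :> R by ring.
  rewrite !cacosE; [|apply/andP; split; nra|apply/andP; split; lra].
  rewrite acos_sqrt2V /f.
  have w01 : 0 <= s2 * sin (t / 2) / 2 <= 1 by apply/andP; split; nra.
  have := asin_ge w01; rewrite asin_acos; [lra|lra].
Qed.

Lemma slice_sqrt2_ge (x : R) : 0 <= x <= s2 -> pi <= slice s2 x.
Proof.
have p0 := @pi_gt0 R; have q0 := sqrt2_gt0; have q2 := sqr_sqrt2.
move=> /andP[x0 xs]; rewrite /slice; set c := Num.sqrt (4 - _).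
have x2 : x ^+ 2 <= 2 by rewrite -q2 ler_pXn2r ?nnegrE// ltW.
have c0 : 0 < c by rewrite sqrtr_gt0; lra.
have c2 : c <= 2.
  rewrite -[leRHS]ger0_norm// -sqrtr_sqr ler_wsqrtr//.
  by have := sqr_ge0 x; nra.
have h : s2 / 2 <= s2 / c by rewrite ler_pM2l// lef_pV2 ?posrE.
have := cacos_nincr h; rewrite [X in _ <= X]cacosE ?acos_sqrt2V; first by lra.
by apply/andP; split; nra.
Qed.

Lemma turning_ge (x : R) : 0 <= x <= s2 -> 2 * pi - 2 * s2 * x <= turning x.
Proof.
have q0 := sqrt2_gt0; have q2 := sqr_sqrt2.
move=> /andP[x0 xs]; rewrite /turning cacosE; last by apply/andP; split; nra.
have := @asin_le_sqrt2 R (x / 2).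
have -> : s2^-1 = s2 / 2.
  by apply: (mulfI (lt0r_neq0 q0)); rewrite mulfV ?gt_eqF// mulrA -expr2 q2 divff.
rewrite asin_acos; last by apply/andP; split; nra.
move=> H; have : pi / 2 - acos (x / 2) <= s2 * (x / 2).
  by apply: H; apply/andP; split; lra.
lra.
Qed.

Lemma curvature_le_sqrt2 :
  strip_density s2 * volume_le s2 <= 2 * pi * curvature_le s2.
Proof.
have p0 := @pi_gt0 R; have q0 := sqrt2_gt0; have q2 := sqr_sqrt2.
have p3 := @pi_ge3 R; have s2_ge0 := ltW q0.
rewrite curvature_leE// volume_leE//.
(* On [0, s2] we have [2 * pi * u <= 4 * pi * turning - q] with
   [u := A - 4 * s2 * x], and [slice] lies between [pi] and [2 * pi]; then
   [u * slice >= pi * (3 / 2 * u - `|u| / 2)], and [`|u|] is bounded by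
   [(2 / 5 * u ^+ 2 + 5 / 2) / 2] to make the lower bound a polynomial [f]. *)
set q := strip_density s2; have qle : q <= _ := strip_density_sqrt2_le.
(* [A] must not exceed pi + 4 sqrt 2 / pi, which is what [h1] needs, and must be large enough for
   [F_ge0]. The value 97 / 20 = 3 + 37 / 20 allows the check from pi >= 3 and sqrt 2 >= 7 / 5 alone,
   since 3 * 37 / 20 <= 4 * 7 / 5. *)
pose A : R := 97 / 20.
have Ap : A * pi <= pi ^+ 2 + 4 * s2.
  have s75 : 7 / 5 <= s2 by nra.
  have : 0 <= (pi - 3) * (pi - 37 / 20) :> R by apply: mulr_ge0; lra.
  by rewrite /A; lra.
pose c : R := 4 * s2.
have c2 : c ^+ 2 = 32 by rewrite exprMn q2; ring.
pose k1 := pi * (3 / 2 * A - (2 / 5 * A ^+ 2 + 5 / 2) / 4).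
pose k2 := pi * (A * c / 10 - 3 / 4 * c).
pose k3 := - (pi * c ^+ 2 / 30).
pose f (x : R) := k1 + 2 * k2 * x + 3 * k3 * (x * x).
pose F (x : R) := k1 * x + k2 * (x * x) + k3 * (x * x * x).
have cf : continuous f.
  move=> t; apply: cvgD.
    by apply: cvgD; [exact: cvg_cst|apply: cvgM; [exact: cvg_cst|exact: cvg_id]].
  apply: cvgM; first exact: cvg_cst.
  by apply: cvgM; exact: cvg_id.
have dF (t : R) : is_derive t 1 F (f t).
  apply: is_derive_eq; rewrite /GRing.scale/= /f; ring.
have fE (x : R) : f x =
    pi * (3 / 2 * (A - c * x) - (2 / 5 * (A - c * x) ^+ 2 + 5 / 2) / 4).
  by rewrite /f /k1 /k2 /k3; field.
have [if_ intf] := continuous_Rintegral s2_ge0 cf dF.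
have F_ge0 : 0 <= F s2 - F 0.
  rewrite /F.
  have -> : k1 * s2 + k2 * (s2 * s2) + k3 * (s2 * s2 * s2) -
      (k1 * 0 + k2 * (0 * 0) + k3 * (0 * 0 * 0)) =
      pi * s2 * (3 / 2 * (A - 4) - (2 / 5 * (A ^+ 2 - 8 * A + 64 / 3) + 5 / 2) / 4).
    by rewrite /k1 /k2 /k3 c2 /c -expr2 q2; field.
  by apply: mulr_ge0; [apply: mulr_ge0; exact: ltW|rewrite /A; lra].
have s22 : s2 < 2 by nra.
have setE : `]0, 2[%classic `&` [set x | x <= s2] = `]0, s2]%classic :> set R.
  apply/seteqP; split=> x /=; rewrite !in_itv/=; first by move=> [/andP[->]].
  by move=> /andP[x0 xs]; rewrite x0 (le_lt_trans xs s22).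
have sub : `]0, s2] `<=` `]0, 2[%classic.
  by apply: subset_itvl; rewrite bnd_simp.
have islice : lambda.-integrable `]0, s2] (EFin \o slice s2).
  have i2 : lambda.-integrable `]0, 2[ (EFin \o slice s2).
    apply: (@bounded_integrable _ _ _ _ (2 * pi)); first exact: measurable_slice.
    by move=> x; rewrite slice_ge0// slice_le.
  by apply: integrableS i2.
have itslice : lambda.-integrable `]0, s2] (EFin \o (fun x => turning x * slice s2 x)).
  have i2 : lambda.-integrable `]0, 2[ (EFin \o (fun x => turning x * slice s2 x)).
    apply: (@bounded_integrable _ _ _ _ (4 * pi * (2 * pi))).
      by apply: measurable_funM; [exact: measurable_turning|exact: measurable_slice].
    move=> x; rewrite mulr_ge0 ?turning_ge0 ?slice_ge0//=.
    by rewrite ler_pM ?turning_ge0 ?slice_ge0 ?turning_le ?slice_le.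
  by apply: integrableS i2.
have weightE (h : R -> R) : \int[lambda]_(x in `]0, 2[) (h x * weight s2 x) =
    \int[lambda]_(x in `]0, s2]) (h x * slice s2 x).
  rewrite -setE Rintegral_mkcondr; apply: eq_Rintegral => x _.
  rewrite patchE /weight (_ : (x \in _) = (x <= s2)); last by apply/idP/idP; rewrite inE.
  by case: ifP => //; rewrite mulr0.
have -> : \int[lambda]_(x in `]0, 2[) weight s2 x = \int[lambda]_(x in `]0, s2]) slice s2 x.
  have := weightE (fun=> 1).
  by under eq_Rintegral do rewrite mul1r; under [RHS]eq_Rintegral do rewrite mul1r.
rewrite weightE -subr_ge0.
have ifo : lambda.-integrable `]0, s2] (EFin \o f).
  apply: integrableS if_ => //.
  by apply: subset_itvr; rewrite bnd_simp.
set I1 := \int[lambda]_(x in `]0, s2]) (turning x * slice s2 x).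
set I0 := \int[lambda]_(x in `]0, s2]) slice s2 x.
have iA : lambda.-integrable `]0, s2]
    (EFin \o (fun x => 4 * pi * (turning x * slice s2 x))).
  by apply: integrableZ_EFin.
have iB : lambda.-integrable `]0, s2] (EFin \o (fun x => q * slice s2 x)).
  by apply: integrableZ_EFin.
have -> : 2 * pi * (2 * I1) - q * I0 =
    \int[lambda]_(x in `]0, s2]) (4 * pi * (turning x * slice s2 x) - q * slice s2 x).
  by rewrite RintegralB// !RintegralZl// -/I1 -/I0; ring.
apply: (@le_trans _ _ (\int[lambda]_(x in `]0, s2]) (2 * pi * f x))).
  rewrite RintegralZl// Rintegral_itv_obnd_cbnd// intf.
  by apply: mulr_ge0 => //; lra.
apply: le_Rintegral => //.
- by apply: integrableZ_EFin.
- by apply: integrableB_EFin.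
move=> x /=; rewrite in_itv/= => /andP[x0 xs].
have x0s : 0 <= x <= s2 by rewrite xs ltW.
have w1 := slice_sqrt2_ge x0s; have w2 := slice_le s2 x.
have t1 := turning_ge x0s.
set w := slice s2 x in w1 w2 *; set t := turning x in t1 *.
rewrite fE.
set u := A - c * x.
have h1 : 2 * pi * u <= 4 * pi * t - q.
  have : 4 * pi * (2 * pi - 2 * s2 * x) <= 4 * pi * t by rewrite ler_pM2l//; lra.
  move: qle Ap; rewrite /u /c; set P := pi ^+ 2 => qle Ap.
  have -> : 4 * pi * (2 * pi - 2 * s2 * x) = 8 * P - 8 * pi * s2 * x.
    by rewrite /P; ring.
  lra.
apply: (@le_trans _ _ (2 * pi * u * w)); last first.
  have -> : 4 * pi * (t * w) - q * w = (4 * pi * t - q) * w by ring.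
  by rewrite ler_wpM2r//; lra.
rewrite -[leRHS]mulrA ler_pM2l; last by lra.
(* The left-hand side below is affine in w on [pi, 2 pi]: the sum of the products in [h2] and [h3]
   is exactly 10 (u w - f x). The number 5 / 2 is the point where the quadratic bound touches the
   absolute value of u. *)
have h2 : 0 <= (w - pi) * (u + 5 / 2) ^+ 2.
  by apply: mulr_ge0; [lra|exact: sqr_ge0].
have h3 : 0 <= (2 * pi - w) * (u - 5 / 2) ^+ 2.
  by apply: mulr_ge0; [lra|exact: sqr_ge0].
lra.
Qed.

Lemma volume_le_ge0 (r : R) : 0 <= volume_le r.
Proof. by rewrite /volume_le fine_ge0// measure_ge0. Qed.

(** If the mean C / V is at least q / (2 p), adding mass 4 p d that carries curvature at least 2 q d
    keeps it so. Here p stands for pi and q for the strip density at the outer edge. *)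
Lemma edge_step (C C' V V' p q d : R) : 0 <= p ->
  V' = V + 4 * p * d -> C + 2 * q * d <= C' -> q * V <= 2 * p * C ->
  q * V' <= 2 * p * C'.
Proof.
move=> p0 -> CC' qV; apply: (@le_trans _ _ (2 * p * (C + 2 * q * d))).
  have -> : q * (V + 4 * p * d) = q * V + 4 * p * q * d by ring.
  have -> : 2 * p * (C + 2 * q * d) = 2 * p * C + 4 * p * q * d by ring.
  by rewrite lerD2r.
by rewrite ler_wpM2l// mulr_ge0.
Qed.

(** Added mass whose mean is at most q / (2 p), itself at most the present mean, cannot raise the
    mean. *)
Lemma mean_step (C C' V V' p q d : R) : 0 <= d -> 0 <= V ->
  V' = V + 4 * p * d -> C' <= C + 2 * q * d -> q * V <= 2 * p * C ->
  C' * V <= C * V'.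
Proof.
move=> d0 V0 -> CC' qV; apply: (@le_trans _ _ ((C + 2 * q * d) * V)).
  by rewrite ler_wpM2r.
have -> : (C + 2 * q * d) * V = C * V + 2 * d * (q * V) by ring.
have -> : C * (V + 4 * p * d) = C * V + 2 * d * (2 * p * C) by ring.
by rewrite lerD2l ler_wpM2l// mulr_ge0.
Qed.

Lemma curvature_le_second_range (r s : R) : s2 <= r -> r <= s -> s <= 2 ->
  curvature_le s * volume_le r <= curvature_le r * volume_le s.
Proof.
move=> r2 rs ss; have p0 := @pi_ge0 R.
have rr : r <= 2 by exact: le_trans ss.
have /andP[Cr _] := curvature_le_increment (lexx s2) r2 rr.
have Vr := volume_le_increment (lexx s2) r2 rr.
have /andP[_ Cs] := curvature_le_increment r2 rs ss.
have Vs := volume_le_increment r2 rs ss.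
(* Take q to be the strip density at r. It is at most the one at sqrt 2, hence q / (2 pi) is at most
   the mean there; growing from sqrt 2 to r adds strips of mean at least q / (2 pi), and growing
   from r to s adds strips of mean at most that. *)
apply: (mean_step _ (volume_le_ge0 r) Vs Cs); first by rewrite subr_ge0.
apply: (edge_step p0 Vr Cr); apply: le_trans curvature_le_sqrt2.
rewrite ler_wpM2r ?volume_le_ge0//; exact: strip_density_nincr.
Qed.
End Sqrt2.

(** * Diameter and curvature in action-angle coordinates *)

Section Polygon.
Variable R : realType.
Local Notation lambda := (@lebesgue_measure R).
Local Notation mu := (lambda \x lambda)%E.
Implicit Types (phi theta : R) (p : aa_coord R).

Lemma vertex_aa_edges phi theta (k : 'I_4) :
  vertex (aa_edges phi theta) k = aa_vertex phi theta k - aa_vertex phi theta ord0.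
Proof.
rewrite /vertex big_mkcond !big_ord_recl big_ord0 /= !rowK.
case: k => -[|[|[|[|//]]]] hk; rewrite /aa_vertex/= ?addr0 ?add0r ?subrr//.
- by rewrite addrC addrA subrK.
- by rewrite [X in _ + X]addrC [X in _ + X]addrA subrK addrC addrA subrK.
Qed.

Lemma cos2E phi : cos phi ^+ 2 = 1 - sin phi ^+ 2.
Proof. by rewrite -(cos2Dsin2 phi) addrK. Qed.

(** With indices from 0, vertices of opposite parity are joined by a unit edge; the even pair spans
    the first diagonal and the odd pair the second. *)
Lemma enorm_aa_vertex phi theta (j k : 'I_4) :
  enorm (aa_vertex phi theta k - aa_vertex phi theta j) =
  Num.sqrt (if j == k then 0 else if odd (j + k) then 1 else
    if odd j then 2 * sin phi ^+ 2 * (1 - cos theta) else 4 * cos phi ^+ 2).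
Proof.
rewrite /enorm /dot; congr Num.sqrt.
have cs := cos2E phi; have ct := cos2E theta.
case: j k => [[|[|[|[|//]]]] hj] [[|[|[|[|//]]]] hk];
  rewrite /aa_vertex /= -?val_eqE/= !big_ord_recr big_ord0 /= !mxE /=; ring: cs ct.
Qed.

Lemma acos_out x : ~~ (-1 <= x <= 1) -> acos x = 0 :> R.
Proof.
move=> x11; rewrite acos.unlock; apply: xgetPN => y /= [_ cy].
by move: x11; rewrite -cy cos_geN1 cos_le1.
Qed.

Lemma acosE x : acos x = if -1 <= x <= 1 then cacos x else 0 :> R.
Proof. by case: ifPn => [/cacosE//|/acos_out]. Qed.

(** The chart is defined for all real coordinates, so measurability is needed also where p.1 / 2
    lies outside [-1, 1] and [acos] takes its default value 0. *)
Lemma measurable_acos : measurable_fun [set: R] (@acos R).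
Proof.
rewrite (_ : @acos R = fun x => if -1 <= x <= 1 then cacos x else 0); last first.
  by apply/funext => x; exact: acosE.
apply: measurable_fun_ifT => //; last exact: measurable_cacos.
by apply: measurable_and; apply: measurable_fun_ler.
Qed.

Lemma acos_total_ge0 x : 0 <= acos x :> R.
Proof. by rewrite acosE; case: ifP => // _; exact: cacos_ge0. Qed.

(** The bound 1 <= r absorbs the four unit sides, leaving only the two diagonals. *)
Lemma diameter_aa_chart r p : 1 <= r ->
  let phi := acos (p.1 / 2) in
  (diameter (aa_chart p) <= r) =
  (Num.sqrt (4 * cos phi ^+ 2) <= r) &&
  (Num.sqrt (2 * sin phi ^+ 2 * (1 - cos p.2)) <= r).
Proof.
move=> r1 phi; have r0 : 0 <= r by exact: le_trans r1.
have D (j k : 'I_4) : enorm (vertex (aa_edges phi p.2) k - vertex (aa_edges phi p.2) j) =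
    enorm (aa_vertex phi p.2 k - aa_vertex phi p.2 j).
  by rewrite !vertex_aa_edges opprB addrA subrK.
rewrite /aa_chart diameter_pi /polygon_diameter /=.
apply/idP/andP => [/bigmax_leP[_ H]|[H1 H2]].
  have {}H (j k : 'I_4) : enorm (aa_vertex phi p.2 k - aa_vertex phi p.2 j) <= r.
    by have /bigmax_leP[_ /(_ k isT)] := H j isT; rewrite D.
  split; [have := H (@Ordinal 4 0 isT) (@Ordinal 4 2 isT)|
          have := H (@Ordinal 4 1 isT) (@Ordinal 4 3 isT)]; by rewrite enorm_aa_vertex.
apply/bigmax_leP; split=> // j _; apply/bigmax_leP; split=> // k _.
rewrite D enorm_aa_vertex; case: ifP => _; first by rewrite sqrtr0.
by case: ifP => _; [rewrite sqrtr1|case: ifP].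
Qed.

Lemma total_curvature_aa_chart p : let phi := acos (p.1 / 2) in
  total_curvature (aa_chart p) =
  2 * acos (cos phi ^+ 2 - sin phi ^+ 2) +
  2 * acos (- cos phi ^+ 2 - sin phi ^+ 2 * cos p.2).
Proof.
move=> phi; rewrite /aa_chart total_curvature_pi /polygon_curvature /=.
have /andP[/forallP unit _] := aa_closed phi p.2.
have A i : angle (row i (aa_edges phi p.2)) (row (ordS i) (aa_edges phi p.2)) =
    acos (if odd i then - cos phi ^+ 2 - sin phi ^+ 2 * cos p.2
          else cos phi ^+ 2 - sin phi ^+ 2).
  rewrite /angle (eqP (unit i)) (eqP (unit (ordS i))) mulr1 divr1; congr acos.
  rewrite /dot !rowK; have cs := cos2E phi; have ct := cos2E p.2.
  case: i => [[|[|[|[|//]]]] hi];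
    rewrite /aa_vertex /= !big_ord_recr big_ord0 /= !mxE /=; ring: cs ct.
under eq_bigr do rewrite A.
by rewrite !big_ord_recr big_ord0 /=; ring.
Qed.

Lemma measurable_trig (f : R -> R) : continuous f ->
  measurable_fun [set: aa_coord R] (fun p => f (acos (p.1 / 2))).
Proof.
move=> cf; apply: (measurableT_comp (continuous_measurable_fun cf)).
by apply: (measurableT_comp measurable_acos); exact: measurable_funM.
Qed.

Lemma measurable_cos_snd : measurable_fun [set: aa_coord R] (fun p => cos p.2).
Proof.
apply: (measurableT_comp (continuous_measurable_fun (@continuous_cos R))).
exact: measurable_snd.
Qed.

Lemma measurable_M4r r : 1 <= r -> measurable (@M4r R r).
Proof.
move=> r1; change (M4_measurable (@M4r R r)); rewrite M4_measurableE.
pose f1 p := Num.sqrt (4 * cos (acos (p.1 / 2)) ^+ 2).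
pose f2 p := Num.sqrt (2 * sin (acos (p.1 / 2)) ^+ 2 * (1 - cos p.2)).
have -> : @aa_chart R @^-1` M4r r = (f1 @^-1` `]-oo, r]) `&` (f2 @^-1` `]-oo, r]).
  by apply/seteqP; split=> p /=; rewrite /M4r/= diameter_aa_chart// !in_itv/= => /andP.
have m1 : measurable_fun setT f1.
  apply: (measurableT_comp (continuous_measurable_fun (@sqrt_continuous R))).
  apply: measurable_funM => //; apply: measurable_funX.
  exact: measurable_trig (@continuous_cos R).
have m2 : measurable_fun setT f2.
  apply: (measurableT_comp (continuous_measurable_fun (@sqrt_continuous R))).
  apply: measurable_funM.
    apply: measurable_funM => //; apply: measurable_funX.
    exact: measurable_trig (@continuous_sin R).
  by apply: measurable_funB => //; exact: measurable_cos_snd.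
apply: measurableI; rewrite -[X in measurable X]setTI.
  by apply: m1 => //; exact: measurable_itv.
by apply: m2 => //; exact: measurable_itv.
Qed.

Lemma measurable_total_curvature_aa_chart :
  measurable_fun [set: aa_coord R] (fun p => total_curvature (aa_chart p)).
Proof.
under eq_fun do rewrite total_curvature_aa_chart.
have mc := measurable_trig (@continuous_cos R).
have ms := measurable_trig (@continuous_sin R).
apply: measurable_funD; apply: measurable_funM => //;
  apply: (measurableT_comp measurable_acos); apply: measurable_funB.
- exact: measurable_funX.
- exact: measurable_funX.
- by apply: measurable_funN; exact: measurable_funX.
- by apply: measurable_funM; [exact: measurable_funX|exact: measurable_cos_snd].
Qed.

Lemma measurable_total_curvature : measurable_fun [set: M4 R] (@total_curvature R).
Proof.
move=> _ A mA; rewrite setTI; change (M4_measurable (@total_curvature R @^-1` A)).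
rewrite M4_measurableE -[X in measurable X]setTI.
exact: measurable_total_curvature_aa_chart.
Qed.

Lemma total_curvature_ge0 (x : M4 R) : 0 <= total_curvature x.
Proof. by apply: sumr_ge0 => i _; exact: acos_total_ge0. Qed.
End Polygon.

(** * The expected curvature as a quotient of coordinate integrals *)

Section ExpectedCurvature.
Variable R : realType.
Local Notation lambda := (@lebesgue_measure R).
Local Notation mu := (lambda \x lambda)%E.
Implicit Types (r : R) (p : aa_coord R).

Lemma cos_snd_half (t : R) : 1 - cos t = 2 * sin (t / 2) ^+ 2.
Proof.
have := cos_mulr2n (t / 2); have -> : t / 2 *+ 2 = t by rewrite mulr2n; field.
by rewrite cos2sin2 mulr2n => ->; ring.
Qed.

Lemma aa_domain_angle p : aa_domain p ->
  [/\ 0 <= acos (p.1 / 2) <= pi / 2, cos (acos (p.1 / 2)) = p.1 / 2,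
      sin (acos (p.1 / 2)) * sin (p.2 / 2) = second_diagonal p / 2 &
      0 <= second_diagonal p / 2 <= 1].
Proof.
move=> Dp; have [x0 x2 d0 xd] := aa_domain_second_diagonal Dp.
have x11 : -1 <= p.1 / 2 <= 1 by apply/andP; split; lra.
split.
- by rewrite acos_ge0//= -acos0; apply: ler_acos; lra.
- by rewrite acosK// in_itv.
- rewrite sin_acos// /second_diagonal.
  have -> : 4 - p.1 ^+ 2 = 2 ^+ 2 * (1 - (p.1 / 2) ^+ 2) by field.
  by rewrite sqrtrM ?sqr_ge0// sqrtr_sqr ger0_norm//; field.
- by have s := sqr_ge0 p.1; apply/andP; split; nra.
Qed.

Lemma aa_chart_M4r r : 1 <= r ->
  @aa_chart R @^-1` M4r r `&` @aa_domain R = @aa_domain R `&` diameter_le r.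
Proof.
move=> r1; rewrite setIC.
have E p : aa_domain p ->
    (diameter (aa_chart p) <= r) = (p.1 <= r) && (second_diagonal p <= r).
  move=> Dp; have [phi2 cphi sphi d01] := aa_domain_angle Dp.
  have [x0 x2 d0 xd] := aa_domain_second_diagonal Dp.
  rewrite diameter_aa_chart// cphi cos_snd_half.
  have -> : 4 * (p.1 / 2) ^+ 2 = p.1 ^+ 2 by field.
  set S := sin (acos _) in sphi *.
  have -> : 2 * S ^+ 2 * (2 * sin (p.2 / 2) ^+ 2) = (2 * (S * sin (p.2 / 2))) ^+ 2.
    by ring.
  have -> : 2 * (S * sin (p.2 / 2)) = second_diagonal p by rewrite sphi; field.
  by rewrite !sqrtr_sqr !ger0_norm// ltW.
apply/seteqP; split=> p [Dp] h; split=> //; move: h; rewrite /M4r/= E//.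
  by move=> /andP.
by move=> [-> ->].
Qed.

(** Both cosines of exterior angles have the form 2 cos^2 a - 1 with cos a half a diagonal. For the
    angles at the ends of the first diagonal this uses d / 2 = sin phi sin(theta / 2). *)
Lemma total_curvature_diagonals p : aa_domain p ->
  total_curvature (aa_chart p) = turning p.1 + turning (second_diagonal p).
Proof.
move=> Dp; have [phi2 cphi sphi d01] := aa_domain_angle Dp.
have [x0 x2 d0 xd] := aa_domain_second_diagonal Dp.
rewrite total_curvature_aa_chart /turning !cacosE; [|lra|lra].
move: phi2 cphi sphi d01; set phi := acos (p.1 / 2); set w := second_diagonal p / 2.
move=> phi2 cphi sphi w01.
have w11 : -1 <= w <= 1 by apply/andP; split; lra.
have acos_double (a : R) : 0 <= a <= pi / 2 -> acos (2 * cos a ^+ 2 - 1) = 2 * a.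
  move=> a2; have -> : 2 * cos a ^+ 2 - 1 = cos (a *+ 2).
    by rewrite cos_mulr2n mulr2n; ring.
  by rewrite cosK ?mulr2n ?in_itv/=; [ring|lra].
have w2 : 0 <= acos w <= pi / 2.
  by rewrite acos_ge0//= -acos0; apply: ler_acos; lra.
have -> : cos phi ^+ 2 - sin phi ^+ 2 = 2 * cos phi ^+ 2 - 1 by rewrite cos2sin2; ring.
have -> : - cos phi ^+ 2 - sin phi ^+ 2 * cos p.2 = 2 * cos (acos w) ^+ 2 - 1.
  rewrite (acosK (_ : w \in `[-1, 1])) ?in_itv//= -sphi exprMn cos2sin2.
  have -> : cos p.2 = 1 - 2 * sin (p.2 / 2) ^+ 2 by rewrite -cos_snd_half; ring.
  ring.
by rewrite !acos_double//; ring.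
Qed.

Lemma expected_total_curvatureE r : 1 <= r ->
  expected_total_curvature r = (volume_le r)^-1 * curvature_le r.
Proof.
move=> r1; rewrite /expected_total_curvature.
have -> : fine (symplectic_volume (@M4r R r)) = volume_le r.
  by rewrite /symplectic_volume /pushforward /mrestr aa_chart_M4r.
congr GRing.mul.
have mM := measurable_M4r r1.
have mc := @measurable_aa_chart R.
have mt : measurable_fun setT (EFin \o @total_curvature R).
  by apply/measurable_EFinP; exact: measurable_total_curvature.
rewrite /curvature_le /Rintegral; congr fine.
transitivity (\int[mrestr mu (@measurable_aa_domain R)]_(p in @aa_chart R @^-1` M4r r)
    (total_curvature (aa_chart p))%:E)%E.
  apply: (@ge0_integral_pushforward _ _ _ _ _ _ mc
    (mrestr mu (@measurable_aa_domain R)) (M4r r) (EFin \o @total_curvature R)) => //.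
  - exact: measurable_funS mt.
  - by move=> x _; rewrite lee_fin total_curvature_ge0.
rewrite ge0_integral_mrestr; last 3 first.
- by rewrite -[X in measurable X]setTI; exact: mc.
- apply/measurable_EFinP; apply: measurable_funTS.
  exact: measurable_total_curvature_aa_chart.
- by move=> p _; rewrite lee_fin total_curvature_ge0.
rewrite aa_chart_M4r//; apply: eq_integral => p; rewrite inE => -[Dp _].
by rewrite total_curvature_diagonals.
Qed.

Lemma volume_le_gt0 r : 1 <= r -> 0 < volume_le r.
Proof.
move=> r1; rewrite -lte_fin -volume_le_fin; have p2 := @pi_ge2 R.
(* On this box l < 1, and d = 2 sin phi sin(theta / 2) <= theta < 1, so the box lies in the region
   for every r >= 1. *)
pose B : set (aa_coord R) := `]0, 1[%classic `*` `[0, 1[%classic.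
have mB : measurable B by apply: measurableX; exact: measurable_itv.
have mS : measurable (@aa_domain R `&` diameter_le r).
  by apply: measurableI; [exact: measurable_aa_domain|exact: measurable_diameter_le].
apply: (@lt_le_trans _ _ (mu B)).
  rewrite product_measure1E//=; [|exact: measurable_itv..].
  by rewrite !lebesgue_measure_itv/= !lte_fin ltr01 oppr0 !adde0 mule1 lte_fin.
apply: (@le_measure _ _ _ mu); rewrite ?inE// => p [/=].
rewrite !in_itv/= => /andP[x0 x1] /andP[t0 t1].
have Dp : aa_domain p.
  by split; rewrite /= in_itv/=; apply/andP; split; lra.
split=> //; split; first by lra.
have [phi2 cphi sphi d01] := aa_domain_angle Dp.
have s0 : 0 <= sin (p.2 / 2) by apply: sin_ge0_pi; lra.
have st : sin (p.2 / 2) <= p.2 / 2 by apply: sin_le; lra.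
have := sin_le1 (acos (p.1 / 2)); nra.
Qed.

Lemma diameter_le_ge2 r : 2 <= r ->
  @aa_domain R `&` diameter_le r = @aa_domain R `&` diameter_le 2.
Proof.
move=> r2; have H s : 2 <= s -> @aa_domain R `&` diameter_le s = @aa_domain R.
  move=> s2; apply/seteqP; split=> [p []//|p Dp].
  have [x0 x2 d0 xd] := aa_domain_second_diagonal Dp.
  have [_ _ _ /andP[_ d1]] := aa_domain_angle Dp.
  by split=> //; split; lra.
by rewrite !H.
Qed.

(** No diagonal exceeds 2, so the mean is constant from r = 2 on; capping there makes the strip
    formulas, which require s <= 2, applicable. *)
Lemma expected_total_curvature_min r : 1 <= r ->
  expected_total_curvature r = expected_total_curvature (Num.min r 2).
Proof.
move=> r1; have [//|r2] := leP r 2.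
rewrite !expected_total_curvatureE//; last by lra.
by rewrite /volume_le /curvature_le diameter_le_ge2// ltW.
Qed.

Lemma expected_total_curvature_nincr (r s : R) : 1 <= r -> r <= s ->
  curvature_le s * volume_le r <= curvature_le r * volume_le s ->
  expected_total_curvature s <= expected_total_curvature r.
Proof.
move=> r1 rs H; have s1 : 1 <= s by exact: le_trans rs.
rewrite !expected_total_curvatureE// ler_pdivrMl ?volume_le_gt0//.
by rewrite mulrCA ler_pdivlMl ?volume_le_gt0// mulrC [leRHS]mulrC.
Qed.
End ExpectedCurvature.

Theorem theorem1 (R : realType) (r r' : R) (hr : 1 <= r) (hrr' : r <= r') :
  expected_total_curvature r' <= expected_total_curvature r.
Proof.
have hr' : 1 <= r' by exact: le_trans hrr'.
rewrite (expected_total_curvature_min hr) (expected_total_curvature_min hr').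
have : Num.min r 2 <= Num.min r' 2 by apply: le_min2.
have : Num.min r' 2 <= 2 by rewrite ge_min lexx orbT.
have : 1 <= Num.min r 2 by rewrite le_min hr; lra.
move: (Num.min r 2) (Num.min r' 2) => {hr hrr' hr'} {}r {}r' r1 r2 rr'.
have r0 : 0 <= r by lra.
have s1 : 1 <= Num.sqrt 2 :> R by rewrite -[leLHS]sqrtr1 ler_wsqrtr//; lra.
have [r's|sr'] := leP r' (Num.sqrt 2).
  by apply: expected_total_curvature_nincr => //; exact: curvature_le_first_range.
have [rs|sr] := leP (Num.sqrt 2) r.
  by apply: expected_total_curvature_nincr => //; exact: curvature_le_second_range.
(* The remaining case r < sqrt 2 < r' is split at sqrt 2, which belongs to both ranges. *)
apply: (@le_trans _ _ (expected_total_curvature (Num.sqrt 2))).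
  apply: expected_total_curvature_nincr => //; first exact: ltW.
  by apply: curvature_le_second_range => //; exact: ltW.
apply: expected_total_curvature_nincr => //; first exact: ltW.
by apply: curvature_le_first_range => //; exact: ltW.
Qed.
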